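(* Every hyperbolic geodesic semimetric space that satisfies (B1) and (B2) (as defined in the context) satisfies geodesic stability.
   Context: A semimetric on a set $X$ is a map $d\colon X\times X\to[0,\infty]$ with $d(x,y)=0$ if and only if $x=y$, and $d(x,y)\le d(x,z)+d(z,y)$ for all $x,y,z\in X$ (no symmetry required); $(X,d)$ is then a semimetric space. For $r\ge 0$ put $\mathcal B^+_r(x)=\{y: d(x,y)\le r\}$ (out-ball), $\mathcal B^-_r(x)=\{y: d(y,x)\le r\}$ (in-ball); for $A\subseteq X$, $\mathcal B^{\pm}_r(A)=\bigcup_{a\in A}\mathcal B^{\pm}_r(a)$. The sets $\{y: d(x,y)<r\}$ generate the forward topology of $X$, and the sets $\{y:d(y,x)<r\}$ generate the backward topology. Paths. Equip a real interval $[a,b]$ with the semimetric $d(s,t)=t-s$ if $s\le t$ and $d(s,t)=\infty$ if $s>t$. A directed path in $X$ is a map $P\colon[a,b]\to X$ that is continuous for the forward topologies and also continuous for the backward topologies; $P(a)$ is its starting point, $P(b)$ its end point. Constant (trivial) paths are allowed. Its length is $\ell(P)=\lim_{N\to\infty}\sum_{i=1}^N d(P(t_{i-1}),P(t_i))$ with $t_i=a+i(b-a)/N$. A path is identified with its image when one speaks of points on $P$ or balls around $P$. An $x$-$y$ geodesic is a directed path $P$ from $x$ to $y$ with $d(P(s),P(t))=\ell(P|_{[s,t]})$ for all $s\le t$. For $\gamma\ge1$, $c\ge0$, a $(\gamma,c)$-quasi-geodesic from $x$ to $y$ is a directed path $P$ from $x$ to $y$ with $\ell(P|_{[s,t]})\le\gamma\,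 d(P(s),P(t))+c$ for all $s\le t$. $X$ is geodesic if there is an $x$-$y$ geodesic for all $x,y\in X$ with $d(x,y)<\infty$. Hyperbolicity. A geodesic triangle consists of three (not necessarily distinct) points and three geodesics (the sides), one between every two of those points (in either direction). It is $\delta$-thin if, whenever $P,Q,R$ are its sides labelled so that the starting point of $P$ is the starting or end point of $Q$ and the end point of $P$ is the starting or end point of $R$, then $P\subseteq\mathcal B^+_\delta(Q)\cup\mathcal B^-_\delta(R)$. A geodesic semimetric space is $\delta$-hyperbolic if all its geodesic triangles are $\delta$-thin, and hyperbolic if it is $\delta$-hyperbolic for some $\delta\ge0$. (B1): there is a function $f\colon\mathbb R\to\mathbb R$ such that for every $x\in X$, every $r\ge0$ and all $y,z\in\mathcal B^+_r(x)$, either $d(y,z)=\infty$ or $d(y,z)\le f(r)$. (B2): the same with $\mathcal B^-_r(x)$ in place of $\mathcal B^+_r(x)$. Geodesic stability. A geodesic semimetric space $X$ satisfies geodesic stability if for all $\gamma\ge1$ and $c\ge0$ there is $\kappa\ge0$ such that for all $x,y\in X$ and all $(\gamma,c)$-quasi-geodesics $P$ and $Q$ from $x$ to $y$, every point of $P$ lies in $\mathcal B^+_\kappa(Q)\cap\mathcal B^-_\kappa(Q)$. *)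

(* Defs.v *)
From HB Require Import structures.
From mathcomp Require Import all_boot all_order all_algebra.
From mathcomp Require Import all_classical all_reals.
From mathcomp Require Import ereal topology normedtype sequences.
Set Implicit Arguments.
Unset Strict Implicit.
Unset Printing Implicit Defensive.
Import Order.TTheory GRing.Theory Num.Theory.
Local Open Scope classical_set_scope.
Local Open Scope ring_scope.
Local Open Scope ereal_scope.

Section Semimetric.
Context {R : realType} {X : Type}.
Implicit Types (d : X -> X -> \bar R) (x y z : X) (A : set X) (r : R).

Definition semimetric d : Prop :=
  [/\ forall x y, 0 <= d x y,
      forall x y, d x y = 0 <-> x = y &
      forall x y z, d x y <= d x z + d z y].

Definition opposite d : X -> X -> \bar R := fun x y => d y x.

Definition out_ball d r x : set X := [set y | d x y <= r%:E].
Definition in_ball d r x : set X := [set y | d y x <= r%:E].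
Definition out_nbhd d r A : set X := \bigcup_(a in A) out_ball d r a.
Definition in_nbhd d r A : set X := \bigcup_(a in A) in_ball d r a.

Definition open_out_balls d : set (set X) :=
  [set B | exists x r, B = [set y | d x y < r%:E]].

(* [X] with the forward topology of [d].  The backward topology of [d] is the
   forward topology of [opposite d]. *)
Definition forward_space d : Type := X.

HB.instance Definition _ d := gen_eqMixin (forward_space d).
HB.instance Definition _ d := gen_choiceMixin (forward_space d).
HB.instance Definition _ d :=
  isSubBaseTopological.Build (forward_space d) (open_out_balls d) id.

End Semimetric.

Definition segment {R : realType} (a b : R) : Type :=
  {t : R | (a <= t <= b)%R}.

Definition segment_dist {R : realType} (a b : R) (s t : segment a b) :
    \bar R :=
  if (sval s <= sval t)%R then (sval t - sval s)%:E else +oo.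

Definition forward_continuous {R : realType} {X Y : Type}
    (dX : X -> X -> \bar R) (dY : Y -> Y -> \bar R) (f : X -> Y) : Prop :=
  continuous (f : forward_space dX -> forward_space dY).

Definition backward_continuous {R : realType} {X Y : Type}
    (dX : X -> X -> \bar R) (dY : Y -> Y -> \bar R) (f : X -> Y) : Prop :=
  forward_continuous (opposite dX) (opposite dY) f.

(* The values of [path_fun] outside of [[path_lo, path_hi]] are irrelevant:
   every notion below only looks at arguments in this interval. *)
Record directed_path {R : realType} {X : Type} (d : X -> X -> \bar R) :=
  DirectedPath {
    path_lo : R;
    path_hi : R;
    path_fun :> R -> X;
    path_le : (path_lo <= path_hi)%R;
    path_forward : forward_continuous (@segment_dist R path_lo path_hi) d
                     (fun t => path_fun (sval t));
    path_backward : backward_continuous (@segment_dist R path_lo path_hi) d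
                     (fun t => path_fun (sval t)) }.

Section Paths.
Context {R : realType} {X : Type} (d : X -> X -> \bar R).
Implicit Types (P Q : directed_path d) (x y : X).

Definition path_start P : X := P (path_lo P).
Definition path_end P : X := P (path_hi P).
Definition path_points P : set X :=
  [set P t | t in [set t : R | (path_lo P <= t <= path_hi P)%R]].
Definition path_endpoints P : set X := [set path_start P; path_end P].

Definition from_to P x y : Prop := path_start P = x /\ path_end P = y.

(* Length of the restriction of [f] to [[a, b]].  For a directed path this
   sequence has a limit in [[0, +oo]] (the supremum over all subdivisions), so
   that [limn] never takes its default value. *)
Definition path_length (f : R -> X) (a b : R) : \bar R :=
  let t N i : R := (a + i%:R * (b - a) / N%:R)%R in
  limn (fun N : nat => \sum_(1 <= i < N.+1) d (f (t N i.-1)) (f (t N i))).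

Definition geodesic x y P : Prop :=
  from_to P x y /\
  forall s t : R, (path_lo P <= s)%R -> (s <= t)%R -> (t <= path_hi P)%R ->
    d (P s) (P t) = path_length P s t.

Definition quasi_geodesic (gamma c : R) x y P : Prop :=
  from_to P x y /\
  forall s t : R, (path_lo P <= s)%R -> (s <= t)%R -> (t <= path_hi P)%R ->
    path_length P s t <= gamma%:E * d (P s) (P t) + c%:E.

Definition geodesic_space : Prop :=
  forall x y, d x y < +oo -> exists P, geodesic x y P.

(* The side [S i] is opposite to the vertex [v i]. *)
Definition geodesic_triangle (v : 'I_3 -> X) (S : 'I_3 -> directed_path d) :
    Prop :=
  forall i j k : 'I_3, uniq [:: i; j; k] ->
    geodesic (v j) (v k) (S i) \/ geodesic (v k) (v j) (S i).

Definition thin (delta : R) (S : 'I_3 -> directed_path d) : Prop :=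
  forall i j k : 'I_3, uniq [:: i; j; k] ->
    path_endpoints (S j) (path_start (S i)) ->
    path_endpoints (S k) (path_end (S i)) ->
    path_points (S i) `<=` out_nbhd d delta (path_points (S j)) `|`
                           in_nbhd d delta (path_points (S k)).

Definition delta_hyperbolic (delta : R) : Prop :=
  forall v S, geodesic_triangle v S -> thin delta S.

Definition hyperbolic : Prop :=
  exists delta : R, (0 <= delta)%R /\ delta_hyperbolic delta.

Definition B1 : Prop :=
  exists f : R -> R, forall (x : X) (r : R), (0 <= r)%R ->
    forall y z, out_ball d r x y -> out_ball d r x z ->
      d y z = +oo \/ d y z <= (f r)%:E.

Definition B2 : Prop :=
  exists f : R -> R, forall (x : X) (r : R), (0 <= r)%R ->
    forall y z, in_ball d r x y -> in_ball d r x z ->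
      d y z = +oo \/ d y z <= (f r)%:E.

Definition geodesic_stability : Prop :=
  forall gamma c : R, (1 <= gamma)%R -> (0 <= c)%R ->
    exists kappa : R, (0 <= kappa)%R /\
      forall x y P Q,
        quasi_geodesic gamma c x y P -> quasi_geodesic gamma c x y Q ->
        path_points P `<=` out_nbhd d kappa (path_points Q) `&`
                           in_nbhd d kappa (path_points Q).

End Paths.

(* Main.v *)
Require Import Defs.
From mathcomp Require Import all_boot all_order all_algebra.
From mathcomp Require Import all_classical all_reals.
From mathcomp Require Import ereal topology normedtype sequences.
From mathcomp Require Import finmap zify ring lra.
Set Implicit Arguments.
Unset Strict Implicit.
Unset Printing Implicit Defensive.
Import Order.TTheory GRing.Theory Num.Theory.
Local Open Scope classical_set_scope.
Local Open Scope ring_scope.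

(** A thin triangle bounds detours: if [d x y <= t] and [d x z <= r] and [z] is
    reachable from [y], then [d y z <= r + M (t + 1)], by (B1); (B2) gives the
    reversed inequality.  With these bounds a side [x, y] of a triangle x, m, y
    lies in an out-ball around the two other sides alone, not only in a mixture
    of an out-ball and an in-ball.  Repeated halving then shows that a geodesic
    is [K n + 1]-close to any chain of [2 ^ n] unit steps with the same ends.

    If all geodesics between points of a quasi-geodesic P stay within D of P,
    then a detour through P near a given point has length linear in D, hence
    the bound improves to [K n + 1 + delta] as soon as [2 ^ n] exceeds that
    length.  Starting from the (finite) length of P, this descends to a constant
    that does not depend on P.  Conversely, P stays near the geodesic: the two
    geodesics through a point of P switch near some point of the geodesic, and
    the part of P in between is short.  Two quasi-geodesics with the same ends
    are compared through a common geodesic. *)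

(** Connectedness of an interval for an arbitrary predicate: [s] is the supremum of the points
    satisfying [A]. Beyond it [A] fails, and if [A s] holds then [s < b], which leaves room on the
    right. *)
Lemma switch_point {R : realType} (A : R -> Prop) (a b : R) :
  a <= b -> A a -> ~ A b ->
  exists2 s, a <= s <= b & forall e, 0 < e ->
    (exists u, [/\ a <= u, u <= s, s - e < u & A u]) /\
    (exists v, [/\ s <= v, v <= b, v < s + e & ~ A v]).
Proof.
move=> ab Aa nAb; pose S := [set u | a <= u <= b /\ A u].
have Sa : S a by split=> //; rewrite lexx.
have Sub : ubound S b by move=> u [/andP[]].
have Ss : has_sup S by split; [exists a | exists b].
have leS : a <= sup S by apply: ub_le_sup => //; exists b.
have Sle : sup S <= b by apply: ge_sup => //; exists a.
exists (sup S) => [|e e0]; first by rewrite leS.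
split.
  have [u [/andP[au ub] Au] lu] := sup_adherent e0 Ss.
  by exists u; split=> //; apply: ub_le_sup; [exists b | split=> //; apply/andP].
have [AS|nAS] := pselect (A (sup S)); last first.
  by exists (sup S); split=> //; lra.
have Sb : sup S < b.
  by rewrite lt_neqAle Sle andbT; apply/eqP => Eb; apply: nAb; rewrite -Eb.
pose v := Num.min b (sup S + e / 2).
have lv : sup S < v by rewrite lt_min Sb; lra.
have vb : v <= b by rewrite ge_min lexx.
have ve : v < sup S + e by rewrite gt_min; apply/orP; right; lra.
exists v; split=> //; first exact: ltW.
move=> Av; suff : v <= sup S by rewrite leNgt lv.
by apply: ub_le_sup; [exists b | split=> //; apply/andP; split=> //; lra].
Qed.

(** * Directed distances and geodesics *)

Section DistanceBounds.
Context {R : realType} {X : Type}.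
Implicit Types (d : X -> X -> \bar R) (x y z p q : X) (r s t l : R).

(** Real upper bounds keep infinite distances out of the arithmetic; [reachable] then expresses
    finiteness of the distance. *)
Definition dle d r x y : Prop := (d x y <= r%:E)%E.

Definition reachable d x y : Prop := exists r, dle d r x y.

Lemma dle_reachable d r x y : dle d r x y -> reachable d x y.
Proof. by exists r. Qed.

Lemma semimetric_opposite d : semimetric d -> semimetric (opposite d).
Proof.
case=> d0 dE dT; split=> [x y|x y|x y z]; rewrite /opposite //.
- by rewrite dE; split=> ->.
- by rewrite addeC.
Qed.

(** A geodesic parametrized by arc length. Continuity is not demanded since it follows from the
    distance formula. *)
Definition geod d x y (G : R -> X) l : Prop :=
  [/\ 0 <= l, G 0 = x, G l = y &
      forall s t, 0 <= s -> s <= t -> t <= l -> d (G s) (G t) = (t - s)%:E].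

Lemma geod_dle d x y G l r s t : geod d x y G l ->
  0 <= s -> s <= t -> t <= l -> t - s <= r -> dle d r (G s) (G t).
Proof. by case=> _ _ _ Gd s0 st tl rE; rewrite /dle Gd// lee_fin. Qed.

(** Distances along a geodesic are exact, so a shortcut between two of its points bounds their
    parameters. Most contradictions below arise this way. *)
Lemma dle_geod d x y G l r s t : geod d x y G l ->
  0 <= s -> s <= t -> t <= l -> dle d r (G s) (G t) -> t - s <= r.
Proof. by case=> _ _ _ Gd s0 st tl; rewrite /dle Gd// lee_fin. Qed.

Lemma geod_length d x y G l r : geod d x y G l -> dle d r x y -> l <= r.
Proof.
move=> Ga; have [l0 {1}<- {1}<- _] := Ga.
by move=> /(dle_geod Ga (lexx 0) l0 (lexx l)); rewrite subr0.
Qed.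

Lemma sub_geod d x y G l s t : geod d x y G l -> 0 <= s -> s <= t -> t <= l ->
  geod d (G s) (G t) (fun u => G (s + u)) (t - s).
Proof.
case=> _ _ _ Gd s0 st tl; split; rewrite ?addr0 ?subrKC//.
- by rewrite subr_ge0.
- by move=> u v u0 uv vl; rewrite Gd; [congr _%:E; ring | lra..].
Qed.

Lemma geod_opposite d x y G l : geod d x y G l ->
  geod (opposite d) y x (fun u => G (l - u)) l.
Proof.
case=> l0 G0 Gl Gd; split; rewrite ?subr0 ?subrr//.
by move=> s t s0 st tl; rewrite /opposite Gd; [congr _%:E; ring | lra..].
Qed.

Section SemimetricBounds.
Variable d : X -> X -> \bar R.
Hypothesis sd : semimetric d.

Lemma dle_ge0 r x y : dle d r x y -> 0 <= r.
Proof. by case: sd => d0 _ _ dr; rewrite -lee_fin; apply: le_trans dr. Qed.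

Lemma dle_refl r x : 0 <= r -> dle d r x x.
Proof.
by case: sd => _ dE _; rewrite /dle; have /dE -> : x = x by []; rewrite lee_fin.
Qed.

Lemma dle_trans r s t x z y :
  dle d r x z -> dle d s z y -> r + s <= t -> dle d t x y.
Proof.
case: sd => _ _ dT xz zy rst; apply: le_trans (dT x y z) _.
by apply: le_trans (leeD xz zy) _; rewrite -EFinD lee_fin.
Qed.

Lemma dle_le r s x y : dle d r x y -> r <= s -> dle d s x y.
Proof. by move=> dr rs; apply: le_trans dr _; rewrite lee_fin. Qed.

Lemma reachable_trans x z y :
  reachable d x z -> reachable d z y -> reachable d x y.
Proof. by move=> [r xz] [s zy]; exists (r + s); apply: dle_trans xz zy _. Qed.

Lemma reachable_fin x y : reachable d x y <-> (d x y < +oo)%E.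
Proof.
case: sd => d0 _ _; split=> [[r] /le_lt_trans -> //|]; first by rewrite ltry.
have := d0 x y; rewrite /reachable /dle; case: (d x y) => // r _ _.
by exists r.
Qed.

Lemma geod_reachable x y G l s t : geod d x y G l ->
  0 <= s -> s <= t -> t <= l -> reachable d (G s) (G t).
Proof. by move=> Ga s0 st tl; exists (t - s); apply: geod_dle Ga _ _ _ _. Qed.

End SemimetricBounds.

End DistanceBounds.

(** * Thin triangles *)

Section ThinTriangles.
Context {R : realType} {X : Type}.
Implicit Types (d : X -> X -> \bar R) (x y z p q : X) (r s t l : R).

Definition geod_points (G : R -> X) l : set X := [set G t | t in `[0, l]].

Lemma geod_pointsP G l q :
  geod_points G l q <-> exists t, [/\ 0 <= t, t <= l & G t = q].
Proof.
split=> [[t /=]|[t [t0 tl Gt]]].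
  by rewrite in_itv /= => /andP[]; exists t.
by exists t => //=; rewrite in_itv /= t0 tl.
Qed.

Lemma geod_points_opposite G l :
  geod_points (fun u => G (l - u)) l = geod_points G l.
Proof.
rewrite predeqE => q; split=> /geod_pointsP[t [t0 tl <-]];
  apply/geod_pointsP; exists (l - t); rewrite ?subKr; split=> //; lra.
Qed.

Definition near_side d delta (A B : set X) p : Prop :=
  (exists2 q, A q & dle d delta q p) \/ (exists2 q, B q & dle d delta p q).

Lemma near_side_opposite d delta A B p :
  near_side (opposite d) delta A B p <-> near_side d delta B A p.
Proof. by split=> -[]; by [left|right]. Qed.

Definition has_geods d : Prop :=
  forall x y, reachable d x y -> exists G l, geod d x y G l.

(** Triangles are oriented from [x] through [m] to [y] and from [x] to [y], a shape preserved by
    reversing [d]. In each [near_side] the first set is the side meeting the start of the side in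
    question, the second the one meeting its end. *)
Definition thin_geods d delta : Prop :=
  forall x m y Gxm lxm Gmy lmy Gxy lxy,
    geod d x m Gxm lxm -> geod d m y Gmy lmy -> geod d x y Gxy lxy ->
    let xm := geod_points Gxm lxm in
    let my := geod_points Gmy lmy in
    let xy := geod_points Gxy lxy in
    [/\ forall p, xy p -> near_side d delta xm my p,
        forall p, xm p -> near_side d delta xy my p &
        forall p, my p -> near_side d delta xm xy p].

Definition out_bounded d (f : R -> R) : Prop :=
  forall x y z r, 0 <= r -> dle d r x y -> dle d r x z -> reachable d y z ->
    dle d (f r) y z.

Lemma has_geods_opposite d : has_geods d -> has_geods (opposite d).
Proof.
move=> ha x y ryx; have [G [l Ga]] := ha _ _ ryx.
by exists (fun u => G (l - u)), l; apply: geod_opposite.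
Qed.

Lemma thin_geods_opposite d delta :
  thin_geods d delta -> thin_geods (opposite d) delta.
Proof.
move=> th x m y Gxm lxm Gmy lmy Gxy lxy.
move=> axm amy axy; have := th _ _ _ _ _ _ _ _ _
  (geod_opposite amy) (geod_opposite axm) (geod_opposite axy).
rewrite !geod_points_opposite => -[T1 T2 T3].
by split=> p pp; apply/near_side_opposite; auto.
Qed.

Lemma geod_points_from d x y G l q : semimetric d -> geod d x y G l ->
  geod_points G l q -> dle d l x q.
Proof.
move=> sd Ga /geod_pointsP[t [t0 tl <-]]; have [_ <- _ _] := Ga.
by apply: geod_dle Ga _ _ _ _; lra.
Qed.

Lemma geod_points_to d x y G l q : semimetric d -> geod d x y G l ->
  geod_points G l q -> dle d l q y.
Proof.
move=> sd Ga /geod_pointsP[t [t0 tl <-]]; have [_ _ <- _] := Ga.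
by apply: geod_dle Ga _ _ _ _; lra.
Qed.

Lemma geod_points_start d x y G l : geod d x y G l -> geod_points G l x.
Proof. by case=> l0 Gx _ _; apply/geod_pointsP; exists 0. Qed.

Lemma geod_points_end d x y G l : geod d x y G l -> geod_points G l y.
Proof. by case=> l0 _ Gy _; apply/geod_pointsP; exists l. Qed.

(** * Linear bounds on detours *)

Section Detour.
Variables (d : X -> X -> \bar R) (delta : R) (f : R -> R).
Hypotheses (sd : semimetric d) (delta0 : 0 <= delta) (ha : has_geods d).
Hypotheses (th : thin_geods d delta) (bf : out_bounded d f).

(** Follow [Gyz] up to a switch point of nearness to [Gxy]. Before it, points lie in the out-ball of
    radius [1 + delta] around [x], as does [y], so [f] bounds their distance from [y]. Just after
    it, thinness leads to [Gxz], whose remaining length is at most [r]. *)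
Lemma detour_step x y z r : dle d 1 x y -> dle d r x z -> reachable d y z ->
  dle d (r + (`|f (1 + delta)| + delta + 1)) y z.
Proof.
have ge0_delta := delta0; move=> dxy dxz ryz.
have [Gxy [lxy axy]] := ha (dle_reachable dxy).
have [Gxz [lxz axz]] := ha (dle_reachable dxz).
have [Gyz [l ayz]] := ha ryz.
have lxy1 := geod_length axy dxy; have lxzr := geod_length axz dxz.
have r0 := dle_ge0 sd dxz.
have [_ _ T] := th axy ayz axz.
have fd : f (1 + delta) <= `|f (1 + delta)| by apply: ler_norm.
have nf0 := normr_ge0 (f (1 + delta)).
pose A u := exists2 q, geod_points Gxy lxy q & dle d delta q (Gyz u).
have [l0 Gy Gz _] := ayz.
have Abound (u : R) : 0 <= u -> u <= l -> A u -> dle d (f (1 + delta)) y (Gyz u).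
  move=> u0 ul [q qxy dq]; apply: (bf (x := x)); first lra.
  - by apply: dle_le dxy _; lra.
  - by apply: (dle_trans sd (geod_points_from sd axy qxy) dq); lra.
  - by rewrite -{1}Gy; apply: geod_reachable ayz _ _ _.
have [Al|nAl] := pselect (A l).
  by rewrite -Gz; apply: dle_le (Abound _ l0 (lexx l) Al) _; lra.
have A0 : A 0.
  by exists y; [apply: geod_points_end axy | rewrite Gy; apply: dle_refl].
have [s /andP[s0 sl] /(_ (1/2))[|[u [u0 us su Au]] [v [sv vl vs nAv]]]] :=
  switch_point l0 A0 nAl; first lra.
have yv : geod_points Gyz l (Gyz v) by apply/geod_pointsP; exists v; split=> //; lra.
case: (T _ yv) => [[q qxy dq]|[q qxz dq]]; first by case: nAv; exists q.
apply: (dle_trans sd (z := Gyz u) (r := f (1 + delta)) (s := r + delta + 1)).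
- by apply: Abound => //; lra.
- apply: (dle_trans sd (z := Gyz v) (r := 1) (s := r + delta)); last lra.
  + by apply: geod_dle ayz _ _ _ _; lra.
  + by apply: (dle_trans sd dq (geod_points_to sd axz qxz)); lra.
- lra.
Qed.

(** Move the base point from [x] to [y] in unit steps along a geodesic; each step costs the constant
    of [detour_step], and at most [t + 1] steps occur. *)
Lemma detour_bound : exists2 M, 0 <= M & forall x y z t r,
  dle d t x y -> dle d r x z -> reachable d y z -> dle d (r + M * (t + 1)) y z.
Proof.
pose M := `|f (1 + delta)| + delta + 1.
have M0 : 0 <= M.
  by have := delta0; rewrite /M; have := normr_ge0 (f (1 + delta)); lra.
exists M => // x y z t r dxy dxz ryz.
have step n : forall x r, dle d n%:R x y -> dle d r x z ->
    dle d (r + M * n%:R) y z.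
  elim: n => [|n IH] {dxy dxz t} {}x {}r dxy dxz.
    rewrite mulr0 addr0; suff -> : y = x by [].
    case: sd => d0 dE _; apply/esym/dE/le_anti; rewrite d0 andbT.
    exact: dxy.
  have [G [l axy]] := ha (dle_reachable dxy).
  have ln := geod_length axy dxy; have [l0 Gx Gy _] := axy.
  pose e := Num.min 1 l.
  have e0 : 0 <= e by rewrite le_min l0 ler01.
  have el : e <= l by rewrite ge_min lexx orbT.
  have e1 : e <= 1 by rewrite ge_min lexx.
  have xe : dle d 1 x (G e) by rewrite -Gx; apply: geod_dle axy _ _ _ _; lra.
  have ey : dle d n%:R (G e) y.
    rewrite -Gy; apply: geod_dle axy _ _ _ _ => //.
    rewrite /e minEle; case: ifP => _; last by rewrite subrr.
    by move: ln; rewrite -natr1; lra.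
  have ez := detour_step xe dxz
    (reachable_trans sd (dle_reachable ey) ryz).
  have := IH _ _ ey ez; rewrite -/M -natr1 => H.
  by apply: dle_le H _; lra.
have t0 := dle_ge0 sd dxy.
pose n := (Num.truncn t).+1.
have tn : t < n%:R by apply: truncnS_gt.
have nt : n%:R <= t + 1 by rewrite /n -natr1 lerD2r truncn_le.
have := step n x r (dle_le dxy (ltW tn)) dxz => H.
by apply: dle_le H _; rewrite lerD2l ler_wpM2l.
Qed.

End Detour.

End ThinTriangles.

(** * One-sided thinness *)

Section TransitiveTriangles.
Context {R : realType} {X : Type}.
Implicit Types (d : X -> X -> \bar R) (x y z p q : X) (r s t l delta M K : R).

(** A substitute for the estimate of [d y z] through [x] that symmetry would give: going against the
    arrow from [x] to [y] costs [M * (t + 1)] instead of [t]. *)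
Definition detour d (M : R) : Prop := forall x y z t r,
  dle d t x y -> dle d r x z -> reachable d y z -> dle d (r + M * (t + 1)) y z.

Definition out_thin d (K : R) : Prop :=
  forall x m y Gxm lxm Gmy lmy Gxy lxy p,
    geod d x m Gxm lxm -> geod d m y Gmy lmy -> geod d x y Gxy lxy ->
    geod_points Gxy lxy p ->
    exists2 q, geod_points Gxm lxm q \/ geod_points Gmy lmy q & dle d K q p.

Lemma detour_le d M N : semimetric d -> M <= N -> detour d M -> detour d N.
Proof.
move=> sd MN dM x y z t r xy xz ryz; apply: dle_le (dM _ _ _ _ _ xy xz ryz) _.
rewrite lerD2l ler_wpM2r// addr_ge0//; exact: dle_ge0 xy.
Qed.

(** Start from the point [Gxy (s - L)] behind [p]. If it is reached from [Gxm], continue along the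
    side to [p]. Otherwise it leads to some [w] on [Gmy]; by thinness of the triangle with vertices
    [Gxy (s - L)], [w], [y], the point [T] beyond [w] leads back to [Gxy], and does so before
    [p]. *)
Lemma out_thinP d delta M : semimetric d -> 0 <= delta -> 0 <= M ->
  has_geods d -> thin_geods d delta -> detour d M ->
  out_thin d (5 * delta + M * (delta + 1) + 2).
Proof.
move=> sd delta0 M0 ha th dM x m y Gxm lxm Gmy lmy Gxy lxy p axm amy axy.
move=> /geod_pointsP[s [s0 sl <-]].
have [T1 _ _] := th _ _ _ _ _ _ _ _ _ axm amy axy.
set c := M * (delta + 1).
have c0 : 0 <= c by apply: mulr_ge0 => //; lra.
(* [T] exceeds by 1 the detour bound from [w] to [Gmy (t + T)] that would hold if the latter were
   near the short geodesic [G1]. [L] exceeds by 1 the bound [2 * delta + T] on how far beyond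
   [Gxy (s - L)] the side is met again. *)
pose T := 2 * delta + c + 1; pose L := 2 * delta + T + 1.
have TE : T = 2 * delta + c + 1 by [].
have LE : L = 2 * delta + T + 1 by [].
have [sL|Ls] := leP s L.
  exists x; first by left; apply: geod_points_start axm.
  by have [_ <- _ _] := axy; apply: geod_dle axy _ _ _ _; lra.
have L0 : 0 <= s - L by lra.
have p0p : dle d L (Gxy (s - L)) (Gxy s) by apply: geod_dle axy _ _ _ _; lra.
have p0xy : geod_points Gxy lxy (Gxy (s - L)).
  by apply/geod_pointsP; exists (s - L); split=> //; lra.
case: (T1 _ p0xy) => [[q qxm dq]|[w wmy p0w]].
  by exists q; [left | apply: (dle_trans sd dq p0p); lra].
have /geod_pointsP[t [t0 tl wE]] := wmy.
have [G1 [l1 a1]] := ha _ _ (dle_reachable p0w).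
have l1d := geod_length a1 p0w.
have awy := sub_geod amy t0 tl (lexx _).
have p0l : s - L <= lxy by lra.
have apy := sub_geod axy L0 p0l (lexx _).
have [_ _ Gy _] := axy; have [_ _ Hy _] := amy.
rewrite Gy in apy; rewrite Hy wE in awy.
have wy : dle d (lmy - t) w y by rewrite -wE -Hy; apply: geod_dle amy _ _ _ _; lra.
have [tT|Tt] := leP (lmy - t) T.
  have : dle d (delta + T) (Gxy (s - L)) y by apply: (dle_trans sd p0w wy _); lra.
  by rewrite -Gy => /(dle_geod axy L0 p0l (lexx _)); lra.
have wv : dle d T w (Gmy (t + T)) by rewrite -wE; apply: geod_dle amy _ _ _ _; lra.
have vmy : geod_points Gmy lmy (Gmy (t + T)).
  by apply/geod_pointsP; exists (t + T); split=> //; lra.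
have vwy : geod_points (fun u => Gmy (t + u)) (lmy - t) (Gmy (t + T)).
  by apply/geod_pointsP; exists T; split=> //; lra.
have [_ _ T3] := th _ _ _ _ _ _ _ _ _ a1 awy apy.
case: (T3 _ vwy) => [[q qpw dq]|[q /geod_pointsP[u [u0 ul <-]] dq]].
  have pv : dle d (2 * delta) (Gxy (s - L)) (Gmy (t + T)).
    by apply: (dle_trans sd (geod_points_from sd a1 qpw) dq _); lra.
  have : dle d (2 * delta + c) (Gmy t) (Gmy (t + T)).
    by rewrite wE; apply: (dM (Gxy (s - L))) => //; apply: dle_reachable wv.
  have tTl : t + T <= lmy by lra.
  have ttT : t <= t + T by lra.
  by move=> /(dle_geod amy t0 ttT tTl); lra.
have p0v : dle d (delta + T) (Gxy (s - L)) (Gmy (t + T)).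
  by apply: (dle_trans sd p0w wv _).
have := dle_trans sd p0v dq (lexx _).
have ul2 : s - L + u <= lxy by lra.
have su : s - L <= s - L + u by lra.
move=> /(dle_geod axy L0 su ul2) uT.
exists (Gmy (t + T)); first by right.
apply: (dle_trans sd (s := L) dq); last lra.
by apply: geod_dle axy _ _ _ _; lra.
Qed.

End TransitiveTriangles.

(** * Chains of unit steps *)

Section Steps.
Context {R : realType} {X : Type}.
Implicit Types (d : X -> X -> \bar R) (A B : set X) (x y z p q : X).
Implicit Types (r s t : R) (k l n : nat).

Fixpoint steps d A k x y : Prop :=
  if k is k'.+1 then exists2 z, A x /\ dle d 1 x z & steps d A k' z y
  else A x /\ x = y.

Lemma steps_sub d A B k x y :
  (forall z, A z -> B z) -> steps d A k x y -> steps d B k x y.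
Proof.
move=> AB; elim: k x => [|k IH] x /=; first by case; split=> //; apply: AB.
by move=> [z [Ax xz] /IH]; exists z => //; split=> //; apply: AB.
Qed.

Lemma steps_cat d A k l x z y :
  steps d A k x z -> steps d A l z y -> steps d A (k + l) x y.
Proof.
elim: k x => [|k IH] x /=; first by move=> [_ ->].
by move=> [u xu uz] zy; exists u => //; apply: IH.
Qed.

Lemma steps_start d A k x y : steps d A k x y -> A x.
Proof. by case: k => [|k] /= [// z []]. Qed.

Lemma steps_end d A k x y : steps d A k x y -> A y.
Proof. by elim: k x => [|k IH] x /= [] => [Ax <-|z _ /IH]. Qed.

Lemma steps_split d A k l x y : steps d A (k + l) x y ->
  exists2 z, steps d A k x z & steps d A l z y.
Proof.
elim: k x => [|k IH] x /=.
  by move=> xy; exists x => //; split=> //; apply: steps_start xy.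
by move=> [u xu /IH[z uz zy]]; exists z => //; exists u.
Qed.

Lemma steps_reachable d A k x y :
  semimetric d -> steps d A k x y -> reachable d x y.
Proof.
move=> sd; elim: k x => [|k IH] x /= [].
  by move=> _ <-; apply: (dle_reachable (r := 0)); apply: dle_refl.
by move=> z [_ xz] /IH; apply: reachable_trans => //; apply: dle_reachable xz.
Qed.

(** A chain is padded by trivial steps at its end; this permits rounding its number of steps up to a
    power of two. *)
Lemma steps_leq d A k l x y :
  semimetric d -> (k <= l)%N -> steps d A k x y -> steps d A l x y.
Proof.
move=> sd /subnKC <- xy; have Ay := steps_end xy; apply: steps_cat xy _.
elim: (l - k)%N => //= n IH; exists y => //; split=> //.
by apply: dle_refl.
Qed.

Lemma steps_opposite d A k x y :
  steps d A k x y -> steps (opposite d) A k y x.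
Proof.
elim: k x => [|k IH] x; first by case=> ? <-.
case=> z [Ax xz] zy; rewrite -addn1; apply: steps_cat (IH _ zy) _.
by exists x; split=> //; apply: steps_start zy.
Qed.

Lemma geod_steps d x y G (l : R) k : semimetric d -> geod d x y G l ->
  l <= k%:R -> steps d (geod_points G l) k x y.
Proof.
move=> sd Ga lk; have [l0 Gx Gy _] := Ga.
suff H n s : 0 <= s -> s <= l -> l - s <= n%:R ->
    steps d (geod_points G l) n (G s) y.
  by rewrite -[x]Gx; apply: H; rewrite ?subr0.
elim: n s => [|n IH] s s0 sl ls.
  split; first by apply/geod_pointsP; exists s.
  by rewrite -Gy; congr G; lra.
pose e := Num.min l (s + 1).
have el : e <= l by rewrite ge_min lexx.
have e1 : e <= s + 1 by rewrite ge_min lexx orbT.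
have se : s <= e by rewrite le_min sl; lra.
exists (G e).
  split; first by apply/geod_pointsP; exists s.
  by apply: geod_dle Ga _ _ _ _ => //; lra.
apply: IH => //; first lra.
rewrite /e minEle; case: ifP => _; first by rewrite subrr.
by move: ls; rewrite -natr1; lra.
Qed.

End Steps.

Section Tame.
Context {R : realType} {X : Type}.
Implicit Types (d : X -> X -> \bar R) (x y z p q : X).
Implicit Types (r s t l delta M K : R).

(* Closed under [opposite d], so that each statement below also yields its
   mirror image. *)
Record tame d delta M K : Prop := Tame {
  tame_semimetric : semimetric d;
  tame_delta_ge0 : 0 <= delta;
  tame_M_ge0 : 0 <= M;
  tame_K_ge0 : 0 <= K;
  tame_geods : has_geods d;
  tame_thin : thin_geods d delta;
  tame_detour : detour d M;
  tame_detour_opposite : detour (opposite d) M;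
  tame_out_thin : out_thin d K;
  tame_out_thin_opposite : out_thin (opposite d) K }.

Lemma tame_opposite d delta M K :
  tame d delta M K -> tame (opposite d) delta M K.
Proof.
case=> *; split=> //; first exact: semimetric_opposite.
- exact: has_geods_opposite.
- exact: thin_geods_opposite.
Qed.

Lemma thin_geods_tame d delta f g : semimetric d -> 0 <= delta ->
  has_geods d -> thin_geods d delta ->
  out_bounded d f -> out_bounded (opposite d) g ->
  exists M K, tame d delta M K.
Proof.
move=> sd delta0 ha th bf bg.
have sd' := semimetric_opposite sd; have ha' := has_geods_opposite ha.
have th' := thin_geods_opposite th.
have [M1 M10 D1] := detour_bound sd delta0 ha th bf.
have [M2 M20 D2] := detour_bound sd' delta0 ha' th' bg.
have M1l : M1 <= M1 + M2 by rewrite lerDl.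
have M2l : M2 <= M1 + M2 by rewrite lerDr.
have M0 : 0 <= M1 + M2 by apply: addr_ge0.
have {}D1 := detour_le sd M1l D1; have {}D2 := detour_le sd' M2l D2.
exists (M1 + M2), (5 * delta + (M1 + M2) * (delta + 1) + 2); split=> //.
- suff : 0 <= (M1 + M2) * (delta + 1) by lra.
  by apply: mulr_ge0 => //; lra.
- exact: out_thinP.
- exact: out_thinP.
Qed.

(* Halving the chain costs [K] each time, by thinness of the triangle spanned
   by its end points and its midpoint. *)
Lemma steps_near_geod d delta M K A n x y G l p : tame d delta M K ->
  steps d A (2 ^ n) x y -> geod d x y G l -> geod_points G l p ->
  exists2 q, A q & dle d (K * n%:R + 1) q p.
Proof.
move=> td; have sd := tame_semimetric td.
elim: n x y G l p => [|n IH] x y G l p xy Ga pG.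
  rewrite mulr0 add0r; exists x; first exact: steps_start xy.
  case: xy => /= z [_ xz] [_ zy]; rewrite zy in xz.
  by apply: (dle_le (geod_points_from sd Ga pG) (geod_length Ga xz)).
have [m xm my] : exists2 z, steps d A (2 ^ n) x z & steps d A (2 ^ n) z y.
  by apply: steps_split; rewrite addnn -mul2n -expnS.
have [G1 [l1 a1]] := tame_geods td (steps_reachable sd xm).
have [G2 [l2 a2]] := tame_geods td (steps_reachable sd my).
have [q qq dq] := tame_out_thin td a1 a2 Ga pG.
suff [c Ac cq] : exists2 c, A c & dle d (K * n%:R + 1) c q.
  by exists c => //; apply: (dle_trans sd cq dq); rewrite -natr1; lra.
by case: qq => [q1|q2]; [apply: (IH _ _ _ _ _ xm a1 q1) | apply: (IH _ _ _ _ _ my a2 q2)].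
Qed.

End Tame.

(** * Coarse geodesics near geodesics *)

Lemma linear_le_expn2 k n : (2 * k <= n -> k * n.+1 <= 2 ^ n)%N.
Proof.
move=> /subnKC <-; elim: (n - 2 * k)%N => [|m IH]; last first.
  by rewrite addnS expnS; move: IH; nia.
rewrite addn0; elim: k => // k IH.
have -> : (2 * k.+1 = 2 + 2 * k)%N by lia.
by rewrite expnD; case: k IH => // k; nia.
Qed.

(** The growth comparison behind the descent: the number of unit steps needed is affine in [n],
    while [n] halvings handle [2 ^ n] of them. *)
Lemma affine_le_expn2 {R : realType} (A B : R) : exists n0 : nat,
  forall n, (n0 <= n)%N -> A * n%:R + B <= (2 ^ n)%:R.
Proof.
pose k := (Num.truncn (`|A| + `|B|)).+1; exists (2 * k)%N => n /linear_le_expn2.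
rewrite -(ler_nat R) natrM; apply: le_trans.
have kAB : `|A| + `|B| <= k%:R by apply/ltW/truncnS_gt.
have -> : n.+1%:R = n%:R + 1 :> R by rewrite -natr1.
have A1 := ler_norm A; have B1 := ler_norm B.
have A0 := normr_ge0 A; have B0 := normr_ge0 B.
have n0 := ler0n R n.
by nra.
Qed.

Lemma nat_between {R : realType} (r : R) :
  0 <= r -> exists2 k : nat, r <= k%:R & k%:R <= r + 1.
Proof.
move=> r0; exists (Num.truncn r).+1; first exact/ltW/truncnS_gt.
by rewrite -natr1 lerD2r truncn_le.
Qed.

Section CoarsePaths.
Context {R : realType} {X : Type}.
Implicit Types (d : X -> X -> \bar R) (x y z p q : X) (P G : R -> X).
Implicit Types (r s t u v w l delta M K a b gamma c D : R) (k n : nat).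

Definition path_part P s t : set X :=
  [set q | exists u, [/\ s <= u, u <= t & P u = q]].

(* What remains of a quasi-geodesic once distances below 1 are ignored: the unit
   steps in [coarse_steps] can be chosen of length at least 1/2. *)
Record coarse_geodesic d gamma c P a b : Prop := CoarseGeodesic {
  coarse_reachable : forall s t, a <= s -> s <= t -> t <= b ->
    reachable d (P s) (P t);
  coarse_between : forall s u t r, a <= s -> s <= u -> u <= t -> t <= b ->
    dle d r (P s) (P t) ->
    dle d (gamma * r + c) (P s) (P u) /\ dle d (gamma * r + c) (P u) (P t);
  coarse_steps : forall s t r k, a <= s -> s <= t -> t <= b ->
    dle d r (P s) (P t) -> 2 * (gamma * r + c) + 2 <= k%:R ->
    steps d (path_part P s t) k (P s) (P t) }.

Lemma coarse_geodesic_opposite d gamma c P a b :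
  coarse_geodesic d gamma c P a b ->
  coarse_geodesic (opposite d) gamma c (fun t => P (- t)) (- b) (- a).
Proof.
case=> Q1 Q2 Q3; split.
- by move=> s t bs st ta; apply: Q1; lra.
- move=> s u t r bs su ut ta dr.
  by have [||||? ?] := Q2 (- t) (- u) (- s) r _ _ _ _ dr; [lra..|split].
- move=> s t r k bs st ta dr rk.
  have H : steps d (path_part P (- t) (- s)) k (P (- t)) (P (- s)).
    by apply: (Q3 _ _ r) => //; lra.
  apply: steps_sub (steps_opposite H) => _ [u [tu us <-]].
  by exists (- u); rewrite opprK; split=> //; lra.
Qed.

(* The constant [D] serves every subpath of [P] at once. *)
Definition path_to_geod d P a b D : Prop :=
  forall u v G l p, a <= u -> u <= v -> v <= b ->
    geod d (P u) (P v) G l -> geod_points G l p ->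
    exists s, [/\ u <= s, s <= v & dle d D (P s) p].

(** Encoded by reversing both [d] and time, so that results on [path_to_geod] apply to it verbatim;
    [geod_to_pathP] gives the direct reading. *)
Definition geod_to_path d P a b D : Prop :=
  path_to_geod (opposite d) (fun t => P (- t)) (- b) (- a) D.

Lemma geod_to_pathP d P a b D u v G l p : geod_to_path d P a b D ->
  a <= u -> u <= v -> v <= b -> geod d (P u) (P v) G l -> geod_points G l p ->
  exists s, [/\ u <= s, s <= v & dle d D p (P s)].
Proof.
move=> E au uv vb Ga pG.
have [|||||s [vs su ds]] := E (- v) (- u) (fun t => G (l - t)) l p; try lra.
- by rewrite !opprK; apply: geod_opposite.
- by rewrite geod_points_opposite.
- by exists (- s); split=> //; lra.
Qed.

Lemma geod_const d x : semimetric d -> geod d x x (fun=> x) 0.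
Proof.
case=> d0 dE _; split=> // s t s0 st t0; have -> : t - s = 0 by lra.
by apply/dE.
Qed.

Section Improve.
Variables (d : X -> X -> \bar R) (delta M K gamma c : R).
Hypotheses (td : tame d delta M K).

Let sd := tame_semimetric td.

(** The start of the descent, with an [n] that depends on [P] through [r]. The summand [delta] only
    matches the form of [path_to_geod_improve]. *)
Lemma steps_path_to_geod P a b n r : coarse_geodesic d gamma c P a b ->
  (forall u v, a <= u -> u <= v -> v <= b -> dle d r (P u) (P v)) ->
  2 * (gamma * r + c) + 2 <= (2 ^ n)%:R ->
  path_to_geod d P a b (K * n%:R + 1 + delta).
Proof.
have delta0 := tame_delta_ge0 td.
move=> cP Pr rn u v G l p au uv vb Ga pG.
have st := coarse_steps cP au uv vb (Pr _ _ au uv vb) rn.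
have [_ [s [us sv <-]] sp] := steps_near_geod td st Ga pG.
by exists s; split=> //; apply: dle_le sp _; lra.
Qed.

(* Bounds the number of unit steps of the detour through [P] in the next lemma:
   [D + 1] to reach [P] and the rest along [P]. *)
Definition improve_bound D :=
  D + 4 + 2 * (gamma * (4 * D + 3 * delta + 2 + 2 * (M * (D + 1))) + c).

(* Only the part of [P] before [P w] matters, where [P w] is close to a point
   of [G] beyond [p]: the geodesic [G2] to [P w] still passes near [p], and
   the points of [P] that the hypotheses provide for [G2] precede [w]. *)
Lemma path_to_geod_improve P a b n D : 0 <= gamma -> 0 <= c ->
  coarse_geodesic d gamma c P a b ->
  path_to_geod d P a b D -> geod_to_path d P a b D ->
  0 <= D -> K * n%:R + 1 <= D -> improve_bound D <= (2 ^ n)%:R ->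
  path_to_geod d P a b (K * n%:R + 1 + delta).
Proof.
have delta0 := tame_delta_ge0 td; have M0 := tame_M_ge0 td.
move=> gamma0 c0 cP Eo Ei D0 KD; rewrite /improve_bound => DN.
move=> u v G l p au uv vb Ga pG.
have MD : 0 <= M * (D + 1) by apply: mulr_ge0 => //; lra.
set m := M * (D + 1) in MD DN.
have /geod_pointsP[t [t0 tl pE]] := pG.
(* [B] exceeds both [delta + D] and [2 * D], which excludes the shortcuts of the two cut-off
   arguments below. *)
pose B : R := 2 * D + delta + 1; have BE : B = 2 * D + delta + 1 by [].
(* Cut off what lies far beyond [p]: [P w] is close to [G (t + B)]. In the triangle with vertices
   [P u], [P w], [G (t + B)], the point [p] cannot be near the short side at [G (t + B)], hence it
   is near [G2]. *)
have [w [G2 [l2 [t2 [uw wv a2 [t20 t2l] [qp l2B]]]]]] :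
    exists w G2 l2 t2, [/\ u <= w, w <= v, geod d (P u) (P w) G2 l2,
      0 <= t2 /\ t2 <= l2 &
      dle d delta (G2 t2) p /\ l2 - t2 <= B + delta + m].
  have [tB|Bt] := leP (l - t) B.
    exists v, G, l, t; split=> //; split; last by lra.
    by rewrite pE; apply: dle_refl.
  have tBl : t + B <= l by lra.
  have p2G : geod_points G l (G (t + B)).
    by apply/geod_pointsP; exists (t + B); split=> //; lra.
  have [w [uw wv wp2]] := Eo _ _ _ _ _ au uv vb Ga p2G.
  have wb : w <= b by lra.
  have [G2 [l2 a2]] := tame_geods td (coarse_reachable cP au uw wb).
  have [G3 [l3 a3]] := tame_geods td (dle_reachable wp2).
  have l3D := geod_length a3 wp2.
  have tB0 : 0 <= t + B by lra.
  have aG := sub_geod Ga (lexx 0) tB0 tBl.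
  have [_ Gu _ _] := Ga; rewrite Gu subr0 in aG.
  have [T1 _ _] := tame_thin td a2 a3 aG.
  have pG' : geod_points (fun s => G (0 + s)) (t + B) p.
    by apply/geod_pointsP; exists t; rewrite add0r; split=> //; lra.
  have pp2 : dle d B p (G (t + B)).
    by rewrite -pE; apply: geod_dle Ga _ _ _ _; lra.
  case: (T1 _ pG') => [[_ /geod_pointsP[t2 [t20 t2l <-]] qp]|[q q3 pq]].
    exists w, G2, l2, t2; split=> //; split=> //.
    have [_ _ Gw _] := a2.
    apply: (dle_geod a2 t20 t2l (lexx _)); rewrite Gw.
    apply: (tame_detour_opposite td (x := G (t + B)) (y := P w) (z := G2 t2)).
    - exact: wp2.
    - by apply: (dle_trans sd qp pp2); lra.
    - by have := geod_reachable a2 t20 t2l (lexx _); rewrite Gw.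
  have : dle d (delta + D) p (G (t + B)).
    by apply: (dle_trans sd pq (geod_points_to sd a3 q3)); lra.
  have ttB : t <= t + B by lra.
  by rewrite -pE => /(dle_geod Ga t0 ttB tBl); lra.
have wb : w <= b by lra.
(* Cut off what lies far before [G2 t2]: go back by [B] and pass to [P s1] along [G4]. Points of
   [G4] are too far from [G2 t2] to be found by [steps_near_geod], because [2 * D < B]; if there is
   no room to go back, [G4] is the constant [P u]. *)
have [t1 [s1 [G4 [l4 [[t10 t12] [us1 s1w] a4 l4D G4P]]]]] :
    exists t1 s1 G4 l4, [/\ 0 <= t1 /\ t1 <= t2, u <= s1 /\ s1 <= w,
      geod d (G2 t1) (P s1) G4 l4, l4 <= D &
      t2 - t1 <= B /\ forall x, geod_points G4 l4 x ->
        dle d (K * n%:R + 1) x (G2 t2) -> exists s, [/\ u <= s, s <= v & P s = x]].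
  have [tB|Bt] := leP t2 B.
    exists 0, u, (fun=> P u), 0; split=> //.
    - by have [_ -> _ _] := a2; apply: geod_const.
    - split=> [|_ /geod_pointsP[? [_ _ <-]] _]; first lra.
      by exists u; split.
  have q1G : geod_points G2 l2 (G2 (t2 - B)).
    by apply/geod_pointsP; exists (t2 - B); split=> //; lra.
  have [s1 [us1 s1w qs1]] := geod_to_pathP Ei au uw wb a2 q1G.
  have [G4 [l4 a4]] := tame_geods td (dle_reachable qs1).
  exists (t2 - B), s1, G4, l4; split=> //; [split; lra | | split; first lra].
    exact: (geod_length a4 qs1).
  move=> x x4 xq; have := dle_trans sd (geod_points_from sd a4 x4) xq (lexx _).
  have t20B : 0 <= t2 - B by lra.
  have t2B : t2 - B <= t2 by lra.
  have l4D := geod_length a4 qs1.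
  by move=> /(dle_geod a2 t20B t2B t2l); lra.
have {G4P} [t12B G4P] := G4P.
have as1 : a <= s1 by lra.
have [_ _ Gw _] := a2.
have t1l : t1 <= l2 by lra.
(* The bound comes from the piece of [G2] after [t1] and a detour through [G4], so it is linear in
   [D] and independent of the length of [P]. *)
have Z : dle d (4 * D + 3 * delta + 2 + 2 * m) (P s1) (P w).
  have q1s : dle d D (G2 t1) (P s1).
    by apply: dle_le (geod_points_from sd a4 (geod_points_end a4)) l4D.
  have q1w : dle d (l2 - t1) (G2 t1) (P w).
    by rewrite -Gw; apply: geod_dle a2 _ _ _ _; lra.
  have := tame_detour td q1s q1w (coarse_reachable cP as1 s1w wb).
  by rewrite -/m => H; apply: dle_le H _; lra.
have [k1 Dk1 k1D] := nat_between D0.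
have Z0 := dle_ge0 sd Z.
set z := 4 * D + 3 * delta + 2 + 2 * m in Z Z0 DN.
have gz : 0 <= gamma * z by apply: mulr_ge0.
have [|k2 zk2 k2z] := @nat_between R (2 * (gamma * z + c) + 2); first lra.
have st2 := coarse_steps cP as1 s1w wb Z zk2.
have st1 := geod_steps sd a4 (le_trans l4D Dk1).
pose A := geod_points G4 l4 `|` path_part P s1 w.
have stA : steps d A (k1 + k2) (G2 t1) (P w).
  apply: (steps_cat (z := P s1)).
  - by apply: steps_sub st1 => x; left.
  - by apply: steps_sub st2 => x; right.
have {}stA : steps d A (2 ^ n) (G2 t1) (P w).
  by apply: steps_leq stA => //; rewrite -(ler_nat R) natrD; lra.
have a5 := sub_geod a2 t10 t1l (lexx _); rewrite Gw in a5.
have q5 : geod_points (fun s => G2 (t1 + s)) (l2 - t1) (G2 t2).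
  by apply/geod_pointsP; exists (t2 - t1); rewrite subrKC; split=> //; lra.
have [x Ax xq] := steps_near_geod td stA a5 q5.
have [s [us sv sx]] : exists s, [/\ u <= s, s <= v & P s = x].
  case: Ax => [x4|[s [s1s sw sx]]]; first exact: G4P.
  by exists s; split=> //; lra.
by exists s; split=> //; rewrite sx; apply: (dle_trans sd xq qp).
Qed.

End Improve.

End CoarsePaths.

(** * Uniform constants and stability of coarse geodesics *)

Section Stability.
Context {R : realType} {X : Type}.
Implicit Types (d : X -> X -> \bar R) (x y z p q : X) (P G : R -> X).
Implicit Types (r s t u v w l delta M K a b gamma c D : R) (k n : nat).

Lemma opp_opp_fun (P : R -> X) : (fun t => P (- - t)) = P.
Proof. by apply/funext => t; rewrite opprK. Qed.

Lemma geod_to_path_opposite d P a b D : path_to_geod d P a b D ->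
  geod_to_path (opposite d) (fun t => P (- t)) (- b) (- a) D.
Proof. by rewrite /geod_to_path !opprK opp_opp_fun. Qed.

(** Descent on [n] for the bounds [D n]: [path_to_geod_improve], applied in both directions, passes
    from [n + 1] to [n] as long as [n0 <= n]. Only the starting index depends on [P]. *)
Lemma path_to_geod_const d delta M K gamma c : tame d delta M K ->
  0 <= gamma -> 0 <= c -> exists2 D, 0 <= D & forall P a b,
    a <= b -> coarse_geodesic d gamma c P a b ->
    path_to_geod d P a b D /\ geod_to_path d P a b D.
Proof.
move=> td gamma0 c0; have td' := tame_opposite td.
have K0 := tame_K_ge0 td; have delta0 := tame_delta_ge0 td.
(* [improve_bound] is affine in [D] with slope [e] and constant term [f]. *)
pose e := 1 + 2 * gamma * (4 + 2 * M).
pose f := 4 + 2 * (gamma * (3 * delta + 2 + 2 * M) + c).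
have [n0 n0P] := affine_le_expn2 (e * K) (e * (K + 1 + delta) + f).
pose D n : R := K * n%:R + 1 + delta.
have D0 n : 0 <= D n.
  by rewrite /D; have : 0 <= K * n%:R by [apply: mulr_ge0]; lra.
exists (D n0) => // P a b ab cP; have cP' := coarse_geodesic_opposite cP.
have [r dr] := coarse_reachable cP (lexx a) ab (lexx b).
(* [coarse_between] is applied twice, from [[a, b]] to [[u, b]] and then to [[u, v]]. *)
pose r' := gamma * (gamma * r + c) + c.
have [n1 n1P] := affine_le_expn2 0 (2 * (gamma * r' + c) + 2).
pose k := maxn n0 n1.
have base : path_to_geod d P a b (D k) /\ geod_to_path d P a b (D k).
  have rk : 2 * (gamma * r' + c) + 2 <= (2 ^ k)%:R.
    by have := n1P k (leq_maxr _ _); rewrite mul0r add0r.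
  have sub u v : a <= u -> u <= v -> v <= b -> dle d r' (P u) (P v).
    move=> au uv vb; have ub : u <= b by lra.
    have [_ drub] := coarse_between cP (lexx a) au ub (lexx b) dr.
    by have [] := coarse_between cP au uv vb (lexx b) drub.
  split; first exact: (steps_path_to_geod td cP sub rk).
  apply: (steps_path_to_geod td' cP' _ rk) => u v bu uv va.
  by apply: sub; lra.
suff desc m : path_to_geod d P a b (D (n0 + m)%N) /\
    geod_to_path d P a b (D (n0 + m)%N) ->
    path_to_geod d P a b (D n0) /\ geod_to_path d P a b (D n0).
  by apply: (desc (k - n0)%N); rewrite subnKC// leq_maxl.
elim: m => [|m IH]; first by rewrite addn0.
rewrite addnS => -[Eo Ei]; apply: IH.
have KD : K * (n0 + m)%:R + 1 <= D (n0 + m).+1.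
  by rewrite /D -natr1; lra.
have ID : improve_bound delta M gamma c (D (n0 + m).+1) <= (2 ^ (n0 + m))%:R.
  apply: le_trans (n0P _ (leq_addr m n0)).
  rewrite /improve_bound /D -natr1 /e /f le_eqVlt; apply/orP; left.
  by apply/eqP; ring.
split; first exact: (path_to_geod_improve td gamma0 c0 cP Eo Ei (D0 _) KD ID).
exact: (path_to_geod_improve td' gamma0 c0 cP' Ei
  (geod_to_path_opposite Eo) (D0 _) KD ID).
Qed.

(** At a switch point of [G], the geodesics to and from [P s] yield [q] and [q'], and the piece of
    [P] from [u1] to [u2] around [s] is short. This bounds the distance from [P s] to [q']. A point
    of [G] at bounded distance before [q'] that reaches [P s] then suffices, by the reversed detour
    bound. *)
Lemma path_out_near_geod d delta M K gamma c D : tame d delta M K ->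
  0 <= gamma -> 0 <= c -> 0 <= D -> exists kappa, forall P a b s G l,
    a <= s -> s <= b -> coarse_geodesic d gamma c P a b ->
    path_to_geod d P a b D -> geod_to_path d P a b D ->
    geod d (P a) (P b) G l ->
    exists2 p, geod_points G l p & dle d kappa p (P s).
Proof.
move=> td gamma0 c0 D0; have sd := tame_semimetric td.
have delta0 := tame_delta_ge0 td; have M0 := tame_M_ge0 td.
pose m := M * (D + 1).
pose m' := M * (delta + 1).
pose Z := gamma * (2 * delta + 1 + m + m) + c.
pose Y := gamma * (delta + D + m) + c.
(* Larger than [2 * delta] and than [D + Y + delta + m'], the two bounds on the distance from
   [G (t - B)] to [G t] that the final contradiction produces. *)
pose B := D + Y + 2 * delta + m' + 1.
have m0 : 0 <= m by apply: mulr_ge0 => //; lra.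
have m'0 : 0 <= m' by apply: mulr_ge0 => //; lra.
have Y0 : 0 <= Y by apply: addr_ge0 => //; apply: mulr_ge0 => //; lra.
have BE : B = D + Y + 2 * delta + m' + 1 by [].
exists (B + 1 + delta + M * (Z + D + 1)) => P a b s G l as_ sb cP Eo Ei aG.
have ab : a <= b by lra.
have [G1 [l1 a1]] := tame_geods td (coarse_reachable cP (lexx a) as_ sb).
have [G2 [l2 a2]] := tame_geods td (coarse_reachable cP as_ sb (lexx b)).
have [T1 _ _] := tame_thin td a1 a2 aG.
have [l0 Ga Gb _] := aG.
pose A t := exists2 q, geod_points G1 l1 q & dle d delta q (G t).
have [t [t' [t0 tt' t'l t't [[q q1 qt] [q' q2 qt']]]]] : exists t t',
    [/\ 0 <= t, t <= t', t' <= l, t' <= t + 1 &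
     A t /\ exists2 q, geod_points G2 l2 q & dle d delta (G t') q].
  (* If [A] holds at the end of [G], the common end [P b] serves as [q']. *)
  have [Al|nAl] := pselect (A l).
    exists l, l; split=> //; first by lra.
    split=> //; exists (P b); first exact: geod_points_end a2.
    by rewrite Gb; apply: dle_refl.
  have A0 : A 0.
    exists (P a); first exact: geod_points_start a1.
    by rewrite Ga; apply: dle_refl.
  have [h /andP[h0 hl] /(_ (1/2))[|[t [t0 th ht At]] [v [hv vl vh nAv]]]] :=
    switch_point l0 A0 nAl; first by lra.
  exists t, v; split=> //; try lra; split=> //.
  have vG : geod_points G l (G v) by apply/geod_pointsP; exists v; split=> //; lra.
  by case: (T1 _ vG) => // [[q q1 qv]]; case: nAv; exists q.
have [u1 [au1 u1s qu1]] := geod_to_pathP Ei (lexx a) as_ sb a1 q1.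
have [u2 [su2 u2b u2q']] := Eo _ _ _ _ _ as_ sb (lexx b) a2 q2.
have qq' : dle d (2 * delta + 1) q q'.
  have tt : dle d 1 (G t) (G t') by apply: geod_dle aG _ _ _ _; lra.
  by apply: (dle_trans sd (dle_trans sd qt tt (lexx _)) qt'); lra.
have u1u2 : u1 <= u2 by lra.
have ru12 := coarse_reachable cP au1 u1u2 u2b.
have u1q' : dle d (2 * delta + 1 + m) (P u1) q'.
  apply: (tame_detour td qu1 qq').
  exact: (reachable_trans sd ru12 (dle_reachable u2q')).
have u12 : dle d (2 * delta + 1 + m + m) (P u1) (P u2).
  exact: (tame_detour_opposite td (x := q') (y := P u2) (z := P u1)).
have [_ su] := coarse_between cP au1 u1s su2 u2b u12.
have sq' : dle d (Z + D) (P s) q' := dle_trans sd su u2q' (lexx _).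
(* [G t] itself need not reach [P s]; going back along [G] by at most [B] provides a point that
   does. *)
suff [h [h0 hl ht hs]] : exists h, [/\ 0 <= h, h <= t, t - h <= B &
    reachable d (G h) (P s)].
  exists (G h); first by apply/geod_pointsP; exists h; split=> //; lra.
  apply: (tame_detour_opposite td (x := q') (y := P s) (z := G h)) => //.
  have ht' : dle d (B + 1) (G h) (G t') by apply: geod_dle aG _ _ _ _; lra.
  exact: (dle_trans sd ht' qt' (lexx _)).
have [tB|Bt] := leP t B.
  exists 0; split=> //; first by lra.
  by rewrite Ga; apply: (coarse_reachable cP).
have tB0 : 0 <= t - B by lra.
have tBl : t - B <= t by lra.
have tl : t <= l by lra.
exists (t - B); split=> //; first by lra.
have pG : geod_points G l (G (t - B)).
  by apply/geod_pointsP; exists (t - B); split=> //; lra.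
have [w [aw wb pw]] := geod_to_pathP Ei (lexx a) ab (lexx b) aG pG.
have [ws|sw] := leP w s.
  exact: (reachable_trans sd (dle_reachable pw) (coarse_reachable cP aw ws sb)).
(* If [w] came after [s], a geodesic point [q3] slightly before [G (t - B)]
   would start a subpath through [P s] whose length is bounded independently
   of [B], although [P s] is not reached before [q], at distance about [B]. *)
exfalso.
have /geod_pointsP[r [r0 rl qE]] := q1.
have a1q := sub_geod a1 (lexx 0) r0 rl.
have aGt := sub_geod aG (lexx 0) t0 tl.
have [_ G1a G1s _] := a1.
have [G3 [l3 a3]] := tame_geods td (dle_reachable qt).
rewrite G1a qE in a1q; rewrite Ga in aGt.
have [T1' _ _] := tame_thin td a1q a3 aGt.
have pGt : geod_points (fun s => G (0 + s)) (t - 0) (G (t - B)).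
  by apply/geod_pointsP; exists (t - B); rewrite add0r; split=> //; lra.
case: (T1' _ pGt) => [[_ /geod_pointsP[r' [r'0 r'r <-]] q3p]|[q3 q33 pq3]]; last first.
  have l3d := geod_length a3 qt.
  have := dle_trans sd pq3 (geod_points_to sd a3 q33) (lexx _).
  by move=> /(dle_geod aG tB0 tBl tl); lra.
rewrite add0r in q3p.
have r'l : r' <= l1 by lra.
have q31 : geod_points G1 l1 (G1 r') by apply/geod_pointsP; exists r'.
have [w' [aw' w's q3w']] := geod_to_pathP Ei (lexx a) as_ sb a1 q31.
have w'w : w' <= w by lra.
have q3w := dle_trans sd q3p pw (lexx _).
have w'w_le : dle d (delta + D + m) (P w') (P w).
  exact: (tame_detour td q3w' q3w (coarse_reachable cP aw' w'w wb)).
have [w's_le _] := coarse_between cP aw' w's (ltW sw) wb w'w_le.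
have := dle_trans sd q3w' w's_le (lexx _).
rewrite -G1s => /(dle_geod a1 r'0 r'l (lexx _)); rewrite -/Y => r'Y.
have q3q : dle d (D + Y) (G1 r') q by rewrite -qE; apply: geod_dle a1 _ _ _ _; lra.
have q3t := dle_trans sd q3q qt (lexx _).
have := tame_detour td q3p q3t (geod_reachable aG tB0 tBl tl).
by move=> /(dle_geod aG tB0 tBl tl); rewrite -/m'; lra.
Qed.

Lemma path_in_near_geod d delta M K gamma c D : tame d delta M K ->
  0 <= gamma -> 0 <= c -> 0 <= D -> exists kappa, forall P a b s G l,
    a <= s -> s <= b -> coarse_geodesic d gamma c P a b ->
    path_to_geod d P a b D -> geod_to_path d P a b D ->
    geod d (P a) (P b) G l ->
    exists2 p, geod_points G l p & dle d kappa (P s) p.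
Proof.
move=> td gamma0 c0 D0.
have [kappa H] := path_out_near_geod (tame_opposite td) gamma0 c0 D0.
exists kappa => P a b s G l as_ sb cP Eo Ei aG.
have := H (fun t => P (- t)) (- b) (- a) (- s) _ l _ _
  (coarse_geodesic_opposite cP) Ei (geod_to_path_opposite Eo).
rewrite !opprK => /(_ _ _ _ (geod_opposite aG))[||p]; [lra..|].
by rewrite geod_points_opposite; exists p.
Qed.

Theorem coarse_geodesic_stability d delta M K gamma c : tame d delta M K ->
  0 <= gamma -> 0 <= c -> exists2 kappa, 0 <= kappa & forall P a b P' a' b' s,
    a <= s -> s <= b -> a' <= b' -> P' a' = P a -> P' b' = P b ->
    coarse_geodesic d gamma c P a b -> coarse_geodesic d gamma c P' a' b' ->
    (exists s', [/\ a' <= s', s' <= b' & dle d kappa (P' s') (P s)]) /\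
    (exists s', [/\ a' <= s', s' <= b' & dle d kappa (P s) (P' s')]).
Proof.
move=> td gamma0 c0; have sd := tame_semimetric td.
have [D D0 HD] := path_to_geod_const td gamma0 c0.
have [k1 H1] := path_out_near_geod td gamma0 c0 D0.
have [k2 H2] := path_in_near_geod td gamma0 c0 D0.
have k10 := ler_norm k1; have k20 := ler_norm k2.
have k1n := normr_ge0 k1; have k2n := normr_ge0 k2.
exists (D + `|k1| + `|k2|); first by lra.
move=> P a b P' a' b' s as_ sb ab' Pa Pb cP cP'.
have ab := le_trans as_ sb.
have [Eo Ei] := HD _ _ _ ab cP; have [Eo' Ei'] := HD _ _ _ ab' cP'.
have [G [l aG]] := tame_geods td (coarse_reachable cP (lexx a) ab (lexx b)).
have aG' := aG; rewrite -Pa -Pb in aG'.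
split.
  have [p pG ps] := H1 _ _ _ _ _ _ as_ sb cP Eo Ei aG.
  have [s' [as' s'b s'p]] := Eo' _ _ _ _ _ (lexx a') ab' (lexx b') aG' pG.
  by exists s'; split=> //; apply: (dle_trans sd s'p ps); lra.
have [p pG ps] := H2 _ _ _ _ _ _ as_ sb cP Eo Ei aG.
have [s' [as' s'b s'p]] := geod_to_pathP Ei' (lexx a') ab' (lexx b') aG' pG.
by exists s'; split=> //; apply: (dle_trans sd ps s'p); lra.
Qed.

End Stability.

(** * Continuity and the length of directed paths *)

Section ForwardTopology.
Context {R : realType} {X : Type} (d : X -> X -> \bar R).
Hypothesis sd : semimetric d.

(** Balls with arbitrary centres form the subbase. The triangle inequality fits a ball centred at
    [x] into each of them that contains [x], and a finite intersection needs only the least of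
    finitely many radii. *)
Lemma nbhs_forward_spaceP (x : forward_space d) (N : set X) :
  nbhs x N <-> exists2 e : R, 0 < e & forall y, (d x y < e%:E)%E -> N y.
Proof.
have [d0 dE dT] := sd; have dxx z : d z z = 0%E by apply/dE.
split=> [|[e e0 eN]]; last first.
  rewrite nbhsE; exists [set y | (d x y < e%:E)%E] => //=.
  split; last by rewrite /= dxx lte_fin.
  exists [set [set y | (d x y < e%:E)%E]].
    move=> _ ->; exists [fset [set y : X | (d x y < e%:E)%E]]%fset.
      by move=> A; rewrite inE => /eqP ->; apply/mem_set; exists x, e.
    rewrite predeqE => y; split=> [H|xy A /=].
      by apply: (H [set y | (d x y < e%:E)%E]); rewrite /= inE.
    by rewrite inE => /eqP ->.
  by rewrite bigcup_set1.
rewrite nbhsE => -[B [[D' sD' <-] [C D'C Cx]] BN].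
have [F FD FC] := sD' _ D'C.
suff [e e0 eC] : exists2 e : R, 0 < e & forall y, (d x y < e%:E)%E -> C y.
  by exists e => // y /eC Cy; apply: BN; exists C.
move: Cx; rewrite -FC => {FC D'C BN sD' D' B C N}.
have Fb A : A \in F -> open_out_balls d A by move=> /FD /set_mem.
move: Fb => {FD} /= Fb Cx.
suff H (s : seq (set X)) : {subset s <= F} -> exists2 e : R, 0 < e &
    forall y, (d x y < e%:E)%E -> forall A, A \in s -> A y.
  by have [e e0 He] := H F (fun _ => id); exists e => // y /He.
elim: s => [|A s IH] sF; first by exists 1.
have [|e e0 He] := IH; first by move=> B Bs; apply: sF; rewrite inE Bs orbT.
have AF : A \in F by apply: sF; rewrite inE eqxx.
have [z [r AE]] := Fb _ AF.
have zx : (d z x < r%:E)%E by have := Cx A AF; rewrite AE.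
have [t zt] : exists t, d z x = t%:E.
  move: (d0 z x) zx; case: (d z x) => // t _ _; by exists t.
have tr : t < r by move: zx; rewrite zt lte_fin.
exists (Num.min e (r - t)); first by rewrite lt_min e0 subr_gt0.
move=> y xy B; rewrite inE => /orP[/eqP -> |Bs].
  rewrite AE /=; apply: le_lt_trans (dT z y x) _; rewrite zt.
  have : (d x y < (r - t)%:E)%E.
    by apply: lt_le_trans xy _; rewrite lee_fin ge_min lexx orbT.
  move: (d0 x y); case: (d x y) => // u _; rewrite -EFinD !lte_fin; lra.
apply: He Bs; apply: lt_le_trans xy _; rewrite lee_fin ge_min lexx//.
Qed.

End ForwardTopology.

Lemma forward_continuousP {R : realType} {X Y : Type}
    (dX : X -> X -> \bar R) (dY : Y -> Y -> \bar R) (f : X -> Y) :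
  semimetric dX -> semimetric dY ->
  forward_continuous dX dY f <-> forall x (e : R), 0 < e ->
    exists2 h : R, 0 < h &
      forall y, (dX x y < h%:E)%E -> (dY (f x) (f y) < e%:E)%E.
Proof.
move=> sX sY; split=> [cf x e e0|H x].
  have /(cf x) : nbhs (f x : forward_space dY) [set y | (dY (f x) y < e%:E)%E].
    by apply/(nbhs_forward_spaceP sY); exists e.
  by move=> /(nbhs_forward_spaceP sX).
move=> N /(nbhs_forward_spaceP sY)[e e0 eN].
apply/(nbhs_forward_spaceP sX); have [h h0 hP] := H x e e0.
by exists h => // y /hP /eN.
Qed.

Lemma semimetric_segment_dist {R : realType} (a b : R) :
  semimetric (@segment_dist R a b).
Proof.
rewrite /segment_dist; split=> [s t|s t|s t u].
- by case: ifPn => // st; rewrite lee_fin subr_ge0.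
- split=> [|->]; last by rewrite lexx subrr.
  case: ifPn => // st [] /eqP; rewrite subr_eq0 => /eqP ts.
  exact/val_inj.
- case: (leP (sval s) (sval u)) => su; last first.
    by rewrite addye ?leey//; case: ifP.
  case: (leP (sval u) (sval t)) => ut; last by rewrite addey// leey.
  by rewrite (le_trans su ut) -EFinD lee_fin; lra.
Qed.

(** The metric content of both continuities: [segment_dist] is infinite towards the left, so the
    forward one controls only points after [s] and the backward one only points before [s]. *)
Definition one_sided_continuous {R : realType} {X : Type}
    (d : X -> X -> \bar R) (f : R -> X) (a b : R) : Prop :=
  forall s e : R, a <= s -> s <= b -> 0 < e -> exists2 h : R, 0 < h &
    (forall u, s <= u -> u <= b -> u < s + h -> dle d e (f s) (f u)) /\
    (forall u, a <= u -> u <= s -> s - h < u -> dle d e (f u) (f s)).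

Section OneSidedContinuity.
Context {R : realType} {X : Type} (d : X -> X -> \bar R).
Hypothesis sd : semimetric d.

Lemma directed_path_one_sided (P : directed_path d) :
  one_sided_continuous d P (path_lo P) (path_hi P).
Proof.
move=> s e as_ sb e0.
have sX := @semimetric_segment_dist R (path_lo P) (path_hi P).
have /(forward_continuousP _ sX sd) F := @path_forward _ _ _ P.
have /(forward_continuousP _ (semimetric_opposite sX) (semimetric_opposite sd))
  B := @path_backward _ _ _ P.
have sI : path_lo P <= s <= path_hi P by rewrite as_.
pose s' : segment (path_lo P) (path_hi P) := exist _ s sI.
have [h1 h10 H1] := F s' e e0; have [h2 h20 H2] := B s' e e0.
exists (Num.min h1 h2); first by rewrite lt_min h10.
split=> [u su ub uh|u au us uh].
  have uI : path_lo P <= u <= path_hi P by rewrite ub (le_trans as_ su).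
  apply/ltW/(H1 (exist _ u uI)); rewrite /segment_dist /= su lte_fin.
  have : Num.min h1 h2 <= h1 by rewrite ge_min lexx.
  by lra.
have uI : path_lo P <= u <= path_hi P by rewrite au (le_trans us sb).
apply/ltW/(H2 (exist _ u uI)); rewrite /opposite /segment_dist /= us lte_fin.
have : Num.min h1 h2 <= h2 by rewrite ge_min lexx orbT.
by lra.
Qed.

Lemma geod_forward x y G l : geod d x y G l ->
  forward_continuous (@segment_dist R 0 l) d (fun t => G (sval t)).
Proof.
move=> [_ _ _ Gd]; apply/(forward_continuousP _ (@semimetric_segment_dist R 0 l) sd).
move=> [s sI] e e0; exists e => // -[t tI].
have /= /andP[s0 sl] := sI; have /= /andP[t0 tl] := tI.
by rewrite /segment_dist /=; case: ifP => // st; rewrite Gd.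
Qed.

Lemma geod_backward x y G l : geod d x y G l ->
  backward_continuous (@segment_dist R 0 l) d (fun t => G (sval t)).
Proof.
move=> [_ _ _ Gd]; apply/(forward_continuousP _
  (semimetric_opposite (@semimetric_segment_dist R 0 l)) (semimetric_opposite sd)).
move=> [s sI] e e0; exists e => // -[t tI].
have /= /andP[s0 sl] := sI; have /= /andP[t0 tl] := tI.
by rewrite /opposite /segment_dist /=; case: ifP => // st; rewrite Gd.
Qed.

Lemma geod_ge0 x y G l : geod d x y G l -> 0 <= l.
Proof. by case. Qed.

Definition path_of_geod x y G l (aG : geod d x y G l) : directed_path d :=
  DirectedPath (geod_ge0 aG) (geod_forward aG) (geod_backward aG).

End OneSidedContinuity.

(** * Partition sums and path length *)

Section PartitionSums.
Context {R : realType} {X : Type} (d : X -> X -> \bar R) (f : R -> X).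
Hypothesis sd : semimetric d.
Implicit Types (s t u v : R) (L : seq R).

Fixpoint partition_sum s L : \bar R :=
  if L is t :: L' then (d (f s) (f t) + partition_sum t L')%E else 0%E.

Lemma partition_sum_ge0 s L : (0 <= partition_sum s L)%E.
Proof.
have [d0 _ _] := sd; elim: L s => //= t L IH s.
by apply: adde_ge0.
Qed.

Lemma partition_sum_cat s L1 L2 : partition_sum s (L1 ++ L2) =
  (partition_sum s L1 + partition_sum (last s L1) L2)%E.
Proof. by elim: L1 s => [|t L IH] s /=; rewrite ?add0e// IH addeA. Qed.

Lemma le_partition_sum s L : (d (f s) (f (last s L)) <= partition_sum s L)%E.
Proof.
have [d0 dE dT] := sd; elim: L s => [|t L IH] s /=.
  by have -> : d (f s) (f s) = 0%E by apply/dE.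
by apply: le_trans (dT _ _ (f t)) _; rewrite leeD2l.
Qed.

Lemma split_sorted (e : rel R) s L t : path e s L -> s <= t ->
  exists L1 L2, [/\ L = L1 ++ L2, last s L1 <= t &
    if L2 is u :: _ then t < u else true].
Proof.
elim: L s => [|u L IH] s /=; first by exists [::], [::].
move=> /andP[su uL] st; have [ut|tu] := leP u t.
  have [L1 [L2 [-> l1 l2]]] := IH _ uL ut.
  by exists (u :: L1), L2.
by exists [::], (u :: L).
Qed.

Definition step_within (h : R) : rel R := fun u v => (u <= v) && (v < u + h).

Lemma path_step_le h s L : path (step_within h) s L -> path <=%R s L.
Proof. by apply: sub_path => u v /andP[]. Qed.

Lemma path_le_last s L : path <=%R s L -> s <= last s L.
Proof.
elim: L s => //= t L IH s /andP[st tL]; exact: le_trans st (IH _ tL).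
Qed.

(** Uniform partitions need not refine one another, so a fine [L'] is compared with [L] directly. A
    point [t] of [L] is inserted between its neighbours [m] and [u] in [L']; one-sided continuity
    makes each of the two new terms cost at most [e / 3], and the induction uses the last third. *)
Lemma partition_sum_mesh a b s L (e : R) : one_sided_continuous d f a b ->
  a <= s -> path <=%R s L -> last s L <= b -> 0 < e ->
  exists2 h : R, 0 < h & forall L', path (step_within h) s L' ->
    last s L' = last s L -> (partition_sum s L <= partition_sum s L' + e%:E)%E.
Proof.
move=> cf; have [d0 _ dT] := sd.
elim: L s e => [|t L IH] s e as_ /=.
  move=> _ _ e0; exists 1 => // L' _ _.
  by apply: adde_ge0; [apply: partition_sum_ge0 | rewrite lee_fin ltW].
move=> /andP[st tL] lb e0; have e3 : 0 < e / 3 by rewrite divr_gt0.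
have at_ : a <= t by lra.
have tb : t <= b by apply: le_trans lb; apply: path_le_last.
have [h1 h10 H1] := IH t (e / 3) at_ tL lb e3.
have [h2 h20 [H2 H3]] := cf t (e / 3) at_ tb e3.
exists (Num.min h1 h2); first by rewrite lt_min h10.
have hm1 : Num.min h1 h2 <= h1 by rewrite ge_min lexx.
have hm2 : Num.min h1 h2 <= h2 by rewrite ge_min lexx orbT.
move: (Num.min h1 h2) hm1 hm2 => h hh1 hh2 L' pL' lL'.
have [L1 [L2 [E l1t Lt]]] := split_sorted pL' st.
move: pL' lL'; rewrite {}E cat_path last_cat partition_sum_cat.
move=> /andP[pL1 pL2] lL'.
have sl := path_le_last (path_step_le pL1).
set m := last s L1 in l1t pL2 lL' sl *.
have dsm : (d (f s) (f m) <= partition_sum s L1)%E by apply: le_partition_sum.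
suff [dm dL] : dle d (e / 3) (f m) (f t) /\
    (partition_sum t L <= partition_sum m L2 + (e / 3)%:E + (e / 3)%:E)%E.
  apply: le_trans (leeD (dT _ _ (f m)) dL) _.
  apply: le_trans (leeD (leeD dsm dm) (lexx _)) _.
  have -> : e%:E = ((e / 3)%:E + (e / 3)%:E + (e / 3)%:E :> \bar R)%E.
    by rewrite -!EFinD; congr _%:E; field.
  by rewrite -!addeA leeD2l// (addeCA _ (partition_sum m L2)).
(* If [L'] has no point after [t], its last point [m] is also that of [L], which forces [m = t]. *)
case: L2 pL2 lL' Lt => [|u L2] /=.
  move=> _ mE _; have tl := path_le_last tL.
  have tm : m = t by apply/le_anti; rewrite l1t mE.
  split; first by rewrite tm; apply: (dle_refl sd); apply: ltW.
  have := H1 [::] isT; rewrite /= -mE tm => /(_ erefl) H.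
  by apply: le_trans H _; rewrite leeDl// lee_fin ltW.
move=> /andP[/andP[mu umh] uL2] lL' tu; split.
  by apply: H3; lra.
have ub : u <= b.
  by rewrite (le_trans _ lb)// -lL'; apply/path_le_last/path_step_le/uL2.
have tuP : path (step_within h1) t (u :: L2).
  apply/andP; split; first by rewrite /step_within (ltW tu); lra.
  apply: sub_path uL2 => v w /andP[vw wv]; apply/andP; split=> //; lra.
have tud : dle d (e / 3) (f t) (f u) by apply: H2; lra.
apply: le_trans (H1 _ tuP lL') _; rewrite leeD2r//=.
apply: le_trans (leeD tud (lexx _)) _.
by rewrite addeC leeD2r// leeDr.
Qed.

Lemma partition_sum_iota (p : nat -> R) k N :
  partition_sum (p k) [seq p i | i <- iota k.+1 N] =
  (\sum_(k.+1 <= i < (k + N).+1) d (f (p i.-1)) (f (p i)))%E.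
Proof.
elim: N k => [|N IH] k /=; first by rewrite addn0 big_geq.
by rewrite IH big_ltn ?addSnnS// ltnS addnS ltnS leq_addr.
Qed.

Section UniformPartition.
Variables s t : R.
Hypothesis st : s <= t.

Definition uniform_point (N i : nat) : R := s + i%:R * (t - s) / N%:R.
Definition uniform_partition (N : nat) : seq R :=
  [seq uniform_point N i | i <- iota 1 N].

Lemma uniform_point0 N : uniform_point N 0 = s.
Proof. by rewrite /uniform_point !mul0r addr0. Qed.

Lemma uniform_partition_last N : (0 < N)%N -> last s (uniform_partition N) = t.
Proof.
move=> N0; rewrite /uniform_partition -{1}(uniform_point0 N) last_map.
have -> : last 0%N (iota 1 N) = N.
  by case: N N0 => // N _; rewrite -(addn1 N) iotaD last_cat /= add1n addn1.
rewrite /uniform_point mulrAC mulfV ?mul1r ?subrKC//.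
by rewrite pnatr_eq0 -lt0n.
Qed.

Lemma uniform_partition_path N (h : R) : (0 < N)%N -> (t - s) / N%:R < h ->
  path (step_within h) s (uniform_partition N).
Proof.
move=> N0 hN; rewrite -{1}(uniform_point0 N) path_map.
have step i : step_within h (uniform_point N i) (uniform_point N i.+1).
  have E : uniform_point N i.+1 = uniform_point N i + (t - s) / N%:R.
    by rewrite /uniform_point -natr1 mulrDl mul1r mulrDl addrA.
  by rewrite /step_within E ltrD2l hN andbT lerDl divr_ge0// subr_ge0.
move: (uniform_point N) step => p step.
by elim: N {N0 hN} 0%N => // n IH k /=; rewrite step IH.
Qed.

End UniformPartition.

(* The sums over uniform partitions are squeezed between the infima of their
   tails and the supremum over all partitions, and [partition_sum_mesh] makes
   both bounds meet. *)
Lemma partition_sum_le_path_length a b s L : one_sided_continuous d f a b ->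
  a <= s -> path <=%R s L -> last s L <= b ->
  (partition_sum s L <= path_length d f s (last s L))%E.
Proof.
move=> cf as_ sL lb; set t := last s L; have st : s <= t := path_le_last sL.
pose u N := partition_sum s (uniform_partition s t N).
have -> : path_length d f s t = limn u.
  rewrite /path_length /=; congr (limn _); apply/funext => N.
  by rewrite -[LHS](partition_sum_iota (uniform_point s t N) 0 N) uniform_point0.
pose V := ereal_sup [set partition_sum s L' | L' in
  [set L' : seq R | path <=%R s L' /\ last s L' = t]].
(* For [N = 0] the partition is empty and need not end at [t]. *)
have uV : forall N, (0 < N)%N -> (u N <= V)%E.
  move=> N N0; apply: ereal_sup_ubound; exists (uniform_partition s t N) => //.
  split; last exact: uniform_partition_last.
  apply: (@path_step_le ((t - s) / N%:R + 1)).
  by apply: uniform_partition_path => //; rewrite ltrDl.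
have near_u L' (e : R) : path <=%R s L' -> last s L' = t -> 0 < e ->
    \forall N \near \oo, (partition_sum s L' <= u N + e%:E)%E.
  move=> sL' lL' e0; have lb' : last s L' <= b by rewrite lL'.
  have [h h0 H] := partition_sum_mesh cf as_ sL' lb' e0.
  pose N0 := (Num.truncn ((t - s) / h)).+1.
  exists N0 => // N /= N0N.
  have Npos : (0 < N)%N by apply: leq_trans N0N.
  apply: H; last by rewrite uniform_partition_last.
  apply: uniform_partition_path => //.
  rewrite ltr_pdivrMr ?ltr0n// mulrC -ltr_pdivrMr//.
  by apply: lt_le_trans (truncnS_gt _) _; rewrite ler_nat.
have LV : limn (einfs u) = V.
  apply/le_anti/andP; split.
    apply: lime_le; first exact: is_cvg_einfs.
    exists 1%N => // N /= N0; apply: le_trans (uV N N0).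
    by apply: ereal_inf_lbound; exists N => //=.
  apply: ge_ereal_sup => _ [L' [sL' lL'] <-].
  apply/lee_addgt0Pr => e e0; rewrite -leeBlDr//.
  apply: lime_ge; first exact: is_cvg_einfs.
  have [N _ HN] := near_u _ _ sL' lL' e0.
  exists N => // n /= Nn; apply: le_ereal_inf_tmp => _ [k /= nk <-].
  by rewrite EFinN leeBlDr//; apply: HN => /=; apply: leq_trans nk.
have cu : u @ \oo --> V.
  apply: (@squeeze_cvge _ _ _ _ (einfs u) u (cst V)).
  - exists 1%N => // N /= N0; rewrite uV// andbT.
    by apply: ereal_inf_lbound; exists N => //=.
  - by rewrite -LV; apply: is_cvg_einfs.
  - exact: cvg_cst.
rewrite (cvg_lim _ cu)//.
by apply: ereal_sup_ubound; exists L.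
Qed.

End PartitionSums.

(** * Quasi-geodesics and geodesics as directed paths *)

Section QuasiGeodesics.
Context {R : realType} {X : Type} (d : X -> X -> \bar R) (f : R -> X) (a b : R).
Hypotheses (sd : semimetric d) (cf : one_sided_continuous d f a b).
Implicit Types (s t u v r : R) (L : seq R).

(** At a switch point [w] of reachability from [f s], continuity leads from a reachable point before
    [w] to [f w] and on to an unreachable point after it. *)
Lemma one_sided_reachable s t : a <= s -> s <= t -> t <= b ->
  reachable d (f s) (f t).
Proof.
move=> as_ st tb; apply: contrapT => nAt.
have As : reachable d (f s) (f s) by apply: dle_reachable (dle_refl sd _ (lexx 0)).
have [w /andP[sw wt] W] := switch_point (A := fun u => reachable d (f s) (f u)) st As nAt.
have [||h h0 [hr hl]] := cf (s := w) _ _ (@ltr01 R); try lra.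
have [[u [su uw wu Au]] [v [wv vt vw nAv]]] := W h h0.
apply: nAv; apply: (reachable_trans sd Au).
apply: (reachable_trans sd (z := f w)).
- by apply: dle_reachable (hl u _ _ _); lra.
- by apply: dle_reachable (hr v _ _ _); lra.
Qed.

(** Greedy choice: each step goes just past a switch point of being within 1/2 of [f s]. It then
    uses up at least 1/2 of every partition sum that continues from there, while its own length is
    at most 1/2 + 1/4 + 1/4. *)
Lemma partition_sum_steps k s t : a <= s -> s <= t -> t <= b ->
  (forall L, path <=%R s L -> last s L = t ->
    (partition_sum d f s L <= (k%:R / 2)%:E)%E) ->
  steps d (path_part f s t) k.+1 (f s) (f t).
Proof.
elim: k s => [|k IH] s as_ st tb H.
all: have fs : path_part f s t (f s) by exists s.
all: have ft : path_part f s t (f t) by exists t.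
all: have dst : (d (f s) (f t) <= partition_sum d f s [:: t])%E by rewrite /= adde0.
  exists (f t) => //; split=> //; apply: le_trans dst _.
  by apply: le_trans (H [:: t] _ _) _; rewrite /= ?st// mul0r lee_fin.
have [d1|nd1] := pselect (dle d 1 (f s) (f t)).
  by apply: (@steps_leq _ _ _ _ 1) => //; exists (f t).
have As : dle d (1 / 2) (f s) (f s) by apply: dle_refl => //; lra.
have nAt : ~ dle d (1 / 2) (f s) (f t).
  by move=> d1; apply: nd1; apply: dle_le d1 _; lra.
have [w /andP[sw wt] W] :=
  switch_point (A := fun u => dle d (1 / 2) (f s) (f u)) st As nAt.
have [|||h h0 [hr hl]] := cf (s := w) (e := 1 / 4); try lra.
have [[u [su uw wu Au]] [v [wv vt vw nAv]]] := W h h0.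
have sv : s <= v by lra.
exists (f v).
  split=> //; apply: (dle_trans sd (dle_trans sd Au (hl u _ _ _) (lexx _))
    (hr v _ _ _)); lra.
apply: (steps_sub (A := path_part f v t)).
  by move=> _ [x [vx xt <-]]; exists x; split=> //; lra.
apply: IH => // [|L vL lL]; first lra.
have := H (v :: L); rewrite /= sv => /(_ vL lL) HL.
move: nAv => /negP; rewrite -ltNge => dv.
rewrite -(leeD2lE (x := (1 / 2)%:E))//; apply: le_trans (leeD (ltW dv) (lexx _)) _.
apply: le_trans HL _; rewrite -EFinD lee_fin -natr1; lra.
Qed.

Lemma quasi_coarse_geodesic gamma c : 0 <= gamma ->
  (forall s t, a <= s -> s <= t -> t <= b ->
    (path_length d f s t <= gamma%:E * d (f s) (f t) + c%:E)%E) ->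
  coarse_geodesic d gamma c f a b.
Proof.
move=> gamma0 H; have [d0 _ _] := sd.
have HL s t r L : a <= s -> path <=%R s L -> last s L = t -> t <= b ->
    dle d r (f s) (f t) -> (partition_sum d f s L <= (gamma * r + c)%:E)%E.
  move=> as_ sL lL tb dr; have st : s <= t by rewrite -lL; apply: path_le_last.
  have lb : last s L <= b by rewrite lL.
  apply: le_trans (partition_sum_le_path_length sd cf as_ sL lb) _.
  rewrite lL; apply: le_trans (H _ _ as_ st tb) _.
  by rewrite EFinD EFinM leeD2r// lee_wpmul2l.
split.
- exact: one_sided_reachable.
- move=> s u t r as_ su ut tb dr.
  have := HL s t r [:: u; t] as_; rewrite /= su ut adde0.
  move=> /(_ isT erefl tb dr) S; split; apply: le_trans S.
  + by rewrite leeDl.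
  + by rewrite leeDr.
- move=> s t r k as_ st tb dr rk.
  have S0 : 0 <= gamma * r + c.
    rewrite -lee_fin; apply: le_trans (HL s t r [:: t] as_ _ erefl tb dr).
      exact: partition_sum_ge0.
    by rewrite /= st.
  (* The summand 2 in [coarse_steps] pays for rounding up to [j] and for the extra step in
     [j.+1]. *)
  have [|j j1 j2] := @nat_between R (2 * (gamma * r + c)); first lra.
  apply: (@steps_leq _ _ _ _ j.+1) => //.
    by rewrite -(ler_nat R) -natr1; lra.
  apply: partition_sum_steps => // L sL lL.
  apply: le_trans (HL s t r L as_ sL lL tb dr) _.
  by rewrite lee_fin; lra.
Qed.

End QuasiGeodesics.

(** * Arc-length parametrization and thin triangles *)

Section GeodesicParametrization.
Context {R : realType} {X : Type} (d : X -> X -> \bar R).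
Hypothesis sd : semimetric d.
Implicit Types (x y : X) (P : directed_path d) (s t u v l : R).

Lemma geodesic_additive x y P s u t : geodesic x y P ->
  path_lo P <= s -> s <= u -> u <= t -> t <= path_hi P ->
  d (P s) (P t) = (d (P s) (P u) + d (P u) (P t))%E.
Proof.
move=> [_ gP] as_ su ut tb; have [_ _ dT] := sd.
apply/le_anti; rewrite dT /= [leRHS]gP//; last by lra.
have := @partition_sum_le_path_length _ _ d P sd _ _ s [:: u; t]
  (directed_path_one_sided sd (P := P)) as_.
by rewrite /= su ut adde0; apply.
Qed.

(** Reparametrize by [tau], the distance from the start. It is nondecreasing by additivity and takes
    all intermediate values by one-sided continuity. It may be constant on intervals, but [P] is
    constant there too, so any choice [T] of preimages works. *)
Lemma geodesic_geod x y P : geodesic x y P -> exists G l, geod d x y G l.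
Proof.
move=> gP; have [[Px Py] _] := gP; have [d0 dE _] := sd.
have cP := directed_path_one_sided sd (P := P).
set a := path_lo P in Px cP *; set b := path_hi P in Py cP *.
have ab : a <= b := Defs.path_le P.
(* On [[a, b]] these distances are finite by [one_sided_reachable], so [fine] does not meet its
   default value there. *)
pose tau t := fine (d (P a) (P t)).
have dtau s t : a <= s -> s <= t -> t <= b -> d (P s) (P t) = (tau t - tau s)%:E.
  move=> as_ st tb; have := geodesic_additive gP (lexx a) as_ st tb.
  have at_ : a <= t by lra.
  have fin u v : a <= u -> u <= v -> v <= b -> exists r, d (P u) (P v) = r%:E.
    move=> au uv vb; have [r] := one_sided_reachable sd cP au uv vb.
    by move: (d0 (P u) (P v)); rewrite /dle; case: (d _ _) => // q; exists q.
  have sb : s <= b by lra.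
  rewrite /tau; have [r ->] := fin _ _ as_ st tb.
  have [p ->] := fin _ _ (lexx a) as_ sb.
  have [q ->] := fin _ _ (lexx a) at_ tb.
  by move=> /= [->]; congr _%:E; ring.
have tau_a : tau a = 0 by rewrite /tau; have /dE -> : P a = P a by [].
have tau_le s t : a <= s -> s <= t -> t <= b -> tau s <= tau t.
  by move=> as_ st tb; rewrite -subr_ge0 -lee_fin -dtau.
have tau_surj c : 0 <= c -> c <= tau b -> exists t, (a <= t <= b) /\ tau t = c.
  move=> c0 cb; have [bc|nbc] := pselect (tau b <= c).
    by exists b; split; [rewrite ab lexx | apply/le_anti; rewrite bc].
  have ac : tau a <= c by rewrite tau_a.
  have [w /andP[aw wb] W] := switch_point (A := fun t => tau t <= c) ab ac nbc.
  exists w; rewrite aw wb; split=> //.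
  apply/le_anti/andP; split; apply/ler_addgt0Pr => e e0.
    have [h h0 [_ hl]] := cP w e aw wb e0.
    have [[u [au uw wu Au]] _] := W h h0.
    have := hl u au uw wu; rewrite /dle dtau// lee_fin; lra.
  have [h h0 [hr _]] := cP w e aw wb e0.
  have [_ [v [wv vb vw /negP nAv]]] := W h h0.
  have := hr v wv vb vw; rewrite /dle dtau// lee_fin.
  by move: nAv; rewrite -ltNge; lra.
pose T c := xget a [set t | a <= t <= b /\ tau t = c].
have TP c : 0 <= c -> c <= tau b -> (a <= T c <= b) /\ tau (T c) = c.
  by move=> c0 cb; apply: (xgetPex a (tau_surj c c0 cb)).
have lt0 : 0 <= tau b by rewrite -tau_a tau_le.
have point s t : a <= s <= b -> a <= t <= b -> tau s = tau t -> P s = P t.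
  move=> /andP[as_ sb] /andP[at_ tb] E.
  have [st|/ltW ts] := leP s t; first by apply/dE; rewrite dtau// E subrr.
  by apply/esym/dE; rewrite dtau// E subrr.
have aI : a <= a <= b by rewrite lexx.
have bI : a <= b <= b by rewrite lexx andbT.
exists (P \o T), (tau b); split=> //=.
- by have [I E] := TP 0 (lexx 0) lt0; rewrite -Px; apply: point => //; rewrite E.
- by have [I E] := TP _ lt0 (lexx _); rewrite -Py; apply: point.
move=> s t s0 st tl; have t0 : 0 <= t by lra.
have sl : s <= tau b by lra.
have [/andP[aT Tb] Es] := TP s s0 sl; have [/andP[aT' Tb'] Et] := TP t t0 tl.
(* Should the chosen preimages come in the wrong order, monotonicity of [tau] forces [s = t]. *)
have [TT|/ltW TT] := leP (T s) (T t); first by rewrite dtau// Es Et.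
have ts : t <= s by rewrite -Es -Et; apply: tau_le.
have -> : s = t by apply/le_anti; rewrite st.
by rewrite subrr; apply/dE.
Qed.

Lemma geod_partition_sum x y G l s L : geod d x y G l -> 0 <= s ->
  path <=%R s L -> last s L <= l ->
  partition_sum d G s L = (last s L - s)%:E.
Proof.
move=> aG; elim: L s => [|t L IH] s s0 /=; first by rewrite subrr.
move=> /andP[st tL] ll; have t0 : 0 <= t by lra.
have tl : t <= l by apply: le_trans (path_le_last tL) ll.
have [_ _ _ Gd] := aG.
by rewrite IH// Gd// -EFinD; congr _%:E; ring.
Qed.

Lemma path_length_geod x y G l s t : geod d x y G l -> 0 <= s -> s <= t ->
  t <= l -> path_length d G s t = (t - s)%:E.
Proof.
move=> aG s0 st tl; apply: lim_near_cst => //; exists 1%N => // N /= N0.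
rewrite -[LHS](@partition_sum_iota _ _ d G (uniform_point s t N) 0 N).
rewrite uniform_point0 (geod_partition_sum aG)//.
- by rewrite uniform_partition_last.
- apply: (@path_step_le _ ((t - s) / N%:R + 1)).
  by apply: uniform_partition_path => //; rewrite ltrDl.
- by rewrite uniform_partition_last.
Qed.

Lemma geodesic_path_of_geod x y G l (aG : geod d x y G l) :
  geodesic x y (path_of_geod sd aG).
Proof.
split; first by have [_ Gx Gy _] := aG.
move=> s t /= s0 st tl; rewrite (path_length_geod aG)//.
by have [_ _ _ Gd] := aG; apply: Gd.
Qed.

Lemma path_points_path_of_geod x y G l (aG : geod d x y G l) :
  path_points (path_of_geod sd aG) = geod_points G l.
Proof.
rewrite predeqE => q; split=> [[t /= /andP[t0 tl] <-]|].
  by apply/geod_pointsP; exists t.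
by move=> /geod_pointsP[t [t0 tl <-]]; exists t => //=; rewrite t0.
Qed.

Lemma geodesic_space_has_geods : geodesic_space d -> has_geods d.
Proof.
by move=> gd x y /(reachable_fin sd)/gd[P]; apply: geodesic_geod.
Qed.

(** Each side admits a labelling that lists first the side at its start and then the side at its
    end; the three index triples below record these labellings. *)
Lemma hyperbolic_thin_geods delta :
  delta_hyperbolic d delta -> thin_geods d delta.
Proof.
move=> hd x m y Gxm lxm Gmy lmy Gxy lxy axm amy axy.
pose S (i : 'I_3) : directed_path d := match val i with
  | 0 => path_of_geod sd amy
  | 1 => path_of_geod sd axy
  | _ => path_of_geod sd axm end.
pose v (i : 'I_3) : X := match val i with 0 => x | 1 => m | _ => y end.
have tri : geodesic_triangle v S.
  move=> [[|[|[|//]]] ?] [[|[|[|//]]] ?] [[|[|[|//]]] ?] //= _;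
  by [left; apply: geodesic_path_of_geod | right; apply: geodesic_path_of_geod].
pose i0 : 'I_3 := Ordinal (isT : (0 < 3)%N).
pose i1 : 'I_3 := Ordinal (isT : (1 < 3)%N).
pose i2 : 'I_3 := Ordinal (isT : (2 < 3)%N).
have [_ xm0 xm1 _] := axm; have [_ my0 my1 _] := amy.
have [_ xy0 xy1 _] := axy.
have near_sides i j k p : uniq [:: i; j; k] ->
    path_endpoints (S j) (path_start (S i)) ->
    path_endpoints (S k) (path_end (S i)) -> path_points (S i) p ->
    near_side d delta (path_points (S j)) (path_points (S k)) p.
  move=> ijk ji ki pi.
  by case: (hd v S tri i j k ijk ji ki p pi) => -[q qq dq]; [left|right]; exists q.
move=> xm my xy; rewrite /xm /my /xy.
split=> p.
- have := near_sides i1 i2 i0 p isT; rewrite /= !path_points_path_of_geod.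
  apply; rewrite /path_endpoints /path_start /path_end /=.
  + by left; rewrite xy0 xm0.
  + by right; rewrite xy1 my1.
- have := near_sides i2 i1 i0 p isT; rewrite /= !path_points_path_of_geod.
  apply; rewrite /path_endpoints /path_start /path_end /=.
  + by left; rewrite xy0 xm0.
  + by left; rewrite xm1 my0.
- have := near_sides i0 i2 i1 p isT; rewrite /= !path_points_path_of_geod.
  apply; rewrite /path_endpoints /path_start /path_end /=.
  + by right; rewrite xm1 my0.
  + by right; rewrite xy1 my1.
Qed.

Lemma B1_out_bounded (f : R -> R) :
  (forall (x : X) (r : R), (0 <= r)%R ->
    forall y z, out_ball d r x y -> out_ball d r x z ->
      d y z = +oo%E \/ (d y z <= (f r)%:E)%E) -> out_bounded d f.
Proof.
move=> H x y z r r0 xy xz /(reachable_fin sd) yz.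
by case: (H x r r0 y z xy xz) => // E; rewrite E in yz.
Qed.

End GeodesicParametrization.

Theorem corollary6p3 (R : realType) (X : Type) (d : X -> X -> \bar R) :
  semimetric d -> geodesic_space d -> hyperbolic d -> B1 d -> B2 d ->
  geodesic_stability d.
Proof.
move=> sd gd [delta [delta0 hd]] [f bf] [g bg] gamma c gamma1 c0.
have gamma0 : 0 <= gamma by lra.
(* In-balls of [d] are out-balls of [opposite d], so (B2) is (B1) for [opposite d] with the two
   points interchanged. *)
have bg' : out_bounded (opposite d) g.
  apply: B1_out_bounded => [|x r r0 y z xy xz]; first exact: semimetric_opposite.
  exact: bg xz xy.
have [M [K td]] := thin_geods_tame sd delta0 (geodesic_space_has_geods sd gd)
  (hyperbolic_thin_geods sd hd) (B1_out_bounded sd bf) bg'.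
have [kappa k0 H] := coarse_geodesic_stability td gamma0 c0.
exists kappa; split=> // x y P Q [[Px Py] qP] [[Qx Qy] qQ] _ [s /= /andP[as_ sb] <-].
have cP := quasi_coarse_geodesic sd (directed_path_one_sided sd (P := P)) gamma0 qP.
have cQ := quasi_coarse_geodesic sd (directed_path_one_sided sd (P := Q)) gamma0 qQ.
have [||[s1 [as1 s1b d1]] [s2 [as2 s2b d2]]] :=
  H _ _ _ _ _ _ s as_ sb (Defs.path_le Q) _ _ cP cQ.
- by rewrite -/(path_start P) Px.
- by rewrite -/(path_end P) Py.
by split; [exists (Q s1) | exists (Q s2)] => //; [exists s1|exists s2] => //=;
  rewrite ?as1 ?as2.
Qed.
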